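(* Let $K=2^m$ ($m\in\mathbb{N}$), $n\ge1$, $L\ge1$, $d\ge K$, and let $U=\frac{1}{\sqrt K}\Phi$ where $\Phi$ is the $K\times K$ Sylvester Hadamard matrix. Let $Q\in\mathbb{R}^{n\times n}$ be orthogonal with $1_n^T=\sqrt n\, e_1^TQ^T$ ($e_1$ the first standard basis vector of $\mathbb{R}^n$), and set $V=U\otimes Q\in\mathbb{R}^{nK\times nK}$. Consider gradient flow $\frac{d\theta}{dt}=-\nabla_\theta\mathcal{L}$ on the deep UFM cross-entropy loss $\mathcal{L}$ with initialization $$W_L=UD_LR_L^T,\quad W_l=R_{l+1}D_lR_l^T\ (l=1,\dots,L-1),\quad H_1=R_1D_0V^T,$$ where $R_1,\dots,R_L\in\mathbb{R}^{d\times d}$ are orthogonal and each $D_l$ (of size $K\times d$, $d\times d$, or $d\times nK$ respectively) is rectangular diagonal whose only possibly nonzero diagonal entries are its first $K$ entries $\alpha^{(l)}_0,\dots,\alpha^{(l)}_{K-1}\ge 0$. Then along the flow the matrices $U,V,R_1,\dots,R_L$ stay fixed and only the $\alpha_i^{(l)}$ evolve; the quantities $(\alpha_i^{(l)})^2-(\alpha_i^{(r)})^2$ are conserved, and $\alpha^{(l)}_0$ is constant for all $l$. Assume balancedness, $\alpha_i^{(l)}=\alpha_i^{(r)}$ for all $l,r\in\{0,\dots,L\}$ and all $i$, and let $a_i=\prod_{l=0}^L\alpha_i^{(l)}$ be the logit singular values. After the change of variables $a'=\frac{1}{K\sqrt n}a$, $t'=\frac{1}{K}(L+1)(K\sqrt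 n)^{\frac{2L}{L+1}}t$ (and dropping primes), the values $a_1,\dots,a_{K-1}$ satisfy $$\frac{da_i}{dt}=\frac{1}{D}\,b_i\,a_i^{\frac{2L}{L+1}},\qquad i=1,\dots,K-1,$$ where $b_i=\sum_{j=1}^{K-1}\Psi_{ij}e^{-(\Psi a)_j}$, $D=1+\sum_{j=1}^{K-1}e^{-(\Psi a)_j}$, $a=(a_1,\dots,a_{K-1})$.
   Context: Sylvester Hadamard matrices: $\Phi_1=(1)$ and $\Phi_{2^m}=\begin{bmatrix}\Phi_{2^{m-1}}&\Phi_{2^{m-1}}\\ \Phi_{2^{m-1}}&-\Phi_{2^{m-1}}\end{bmatrix}$; rows/columns are indexed $0,\dots,K-1$. $\Psi\in\mathbb{R}^{(K-1)\times(K-1)}$ is the matrix obtained from $1_K1_K^T-\Phi$ by deleting its first row and first column. Deep UFM: parameters $W_L\in\mathbb{R}^{K\times d}$, $W_{L-1},\dots,W_1\in\mathbb{R}^{d\times d}$, $H_1\in\mathbb{R}^{d\times nK}$, logit matrix $Z=W_L\cdots W_1H_1\in\mathbb{R}^{K\times nK}$ with columns $z_{ic}$ ordered by class (column $(c-1)n+i$ for sample $i$ of class $c$), and loss $\mathcal{L}=-\sum_{c=1}^K\sum_{i=1}^n\log\frac{\exp((z_{ic})_c)}{\sum_{c'}\exp((z_{ic})_{c'})}$.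
   Formalization: The columns of V=U⊗Q are reordered so that its first K columns are u_i⊗q_1=u_i⊗1_n/√n (rows stay class-major); with the literal column order of U⊗Q the logits would not depend on the class and the claim fails for n≥2, K≥2. *)

(* Defs.v *)
From HB Require Import structures.
From mathcomp Require Import all_boot all_order all_algebra.
From mathcomp Require Import all_classical all_reals all_analysis.
From mathcomp Require Import mxtens.
Set Implicit Arguments. Unset Strict Implicit. Unset Printing Implicit Defensive.
Import Order.TTheory GRing.Theory Num.Theory.
Local Open Scope ring_scope.

Section Defs.
Variable R : realType.

(* Sylvester Hadamard matrix Phi_{2^m}, defined entrywise by the block
   recursion Phi_{2^(m+1)} = [[Phi, Phi],[Phi, -Phi]] (indices 0..2^m-1). *)
Fixpoint had (m : nat) (i j : nat) : R :=
  match m with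
  | 0 => 1
  | m'.+1 =>
    if (i < 2 ^ m')%N then
      (if (j < 2 ^ m')%N then had m' i j else had m' i (j - 2 ^ m'))
    else
      (if (j < 2 ^ m')%N then had m' (i - 2 ^ m') j
       else - had m' (i - 2 ^ m') (j - 2 ^ m'))
  end.

Definition Hadamard (m : nat) : 'M[R]_(2 ^ m) := \matrix_(i, j) had m i j.

Definition Umx (m : nat) : 'M[R]_(2 ^ m) :=
  (Num.sqrt (2 ^ m)%:R)^-1 *: Hadamard m.

(* Psi = (1 1^T - Phi) with first row/column deleted; we keep the original
   row/column labels 1..K-1 of Phi, i.e. Psi_{ij} = 1 - Phi_{ij}, 1<=i,j<=K-1. *)
Definition Psi (m : nat) (i j : nat) : R := 1 - had m i j.

(* V = U (x) Q  (Kronecker product, mathcomp-real-closed's [tensmx]).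
   Rows are indexed class-major, row c*n+s <-> (class c, sample s), matching
   the column ordering of Z.  Columns are labelled so that column j*K+b is the
   column u_b (x) q_j of U (x) Q; hence the first K columns of V are
   u_b (x) q_0 = u_b (x) 1_n / sqrt n. *)
Definition Vmx (m n : nat) (Q : 'M[R]_n) : 'M[R]_(2 ^ m * n, n * 2 ^ m) :=
  \matrix_(r, k)
    ((Umx m *t Q) r (mxtens_index ((mxtens_unindex k).2, (mxtens_unindex k).1))).

Definition DL (m d : nat) (a : nat -> R) : 'M[R]_(2 ^ m, d) :=
  \matrix_(i, j) (if val i == val j then a i else 0).
Definition Dmid (m d : nat) (a : nat -> R) : 'M[R]_d :=
  \matrix_(i, j) (if (val i == val j) && (i < 2 ^ m)%N then a i else 0).
Definition D0 (m n d : nat) (a : nat -> R) : 'M[R]_(d, n * 2 ^ m) :=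
  \matrix_(i, j) (if (val i == val j) && (i < 2 ^ m)%N then a i else 0).

Fixpoint chain (d : nat) (Wm : nat -> 'M[R]_d) (k : nat) : 'M[R]_d :=
  match k with
  | 0 => 1%:M
  | k'.+1 => Wm k'.+1 *m chain Wm k'
  end.

(* cross-entropy loss; column mxtens_index (c,s) = c*n+s is sample s of class c *)
Definition CE (m n : nat) (Z : 'M[R]_(2 ^ m, 2 ^ m * n)) : R :=
  - \sum_(c < 2 ^ m) \sum_(s < n)
      ln (expR (Z c (mxtens_index (c, s))) /
          \sum_(c' < 2 ^ m) expR (Z c' (mxtens_index (c, s)))).

Definition ufm_loss (m n d L : nat) (WL : 'M[R]_(2 ^ m, d))
  (Wm : nat -> 'M[R]_d) (H : 'M[R]_(d, 2 ^ m * n)) : R :=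
  CE (WL *m chain Wm L.-1 *m H).

Definition grad_WL (m n d L : nat) (WL : 'M[R]_(2 ^ m, d)) (Wm : nat -> 'M[R]_d)
  (H : 'M[R]_(d, 2 ^ m * n)) (p : 'I_(2 ^ m)) (q : 'I_d) : R :=
  derive1 (fun s : R => ufm_loss L (WL + s *: delta_mx p q) Wm H) 0.
Definition grad_Wm (m n d L : nat) (WL : 'M[R]_(2 ^ m, d)) (Wm : nat -> 'M[R]_d)
  (H : 'M[R]_(d, 2 ^ m * n)) (l : nat) (p q : 'I_d) : R :=
  derive1 (fun s : R => ufm_loss L WL
    (fun k => if k == l then Wm k + s *: delta_mx p q else Wm k) H) 0.
Definition grad_H (m n d L : nat) (WL : 'M[R]_(2 ^ m, d)) (Wm : nat -> 'M[R]_d)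
  (H : 'M[R]_(d, 2 ^ m * n)) (p : 'I_d) (q : 'I_(2 ^ m * n)) : R :=
  derive1 (fun s : R => ufm_loss L WL Wm (H + s *: delta_mx p q)) 0.

Definition Psi_a (m : nat) (a : nat -> R) (j : nat) : R :=
  \sum_(1 <= k < 2 ^ m) Psi m j k * a k.
Definition bcoef (m : nat) (a : nat -> R) (i : nat) : R :=
  \sum_(1 <= j < 2 ^ m) Psi m i j * expR (- Psi_a m a j).
Definition Dden (m : nat) (a : nat -> R) : R :=
  1 + \sum_(1 <= j < 2 ^ m) expR (- Psi_a m a j).

Definition e1row (n : nat) : 'rV[R]_n := \row_(j < n) (val j == 0%N)%:R.

End Defs.

Arguments had {R} m i j.
Arguments Hadamard {R} m.
Arguments Umx {R} m.
Arguments Psi {R} m i j.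
Arguments Vmx {R} m n Q.
Arguments DL {R} m d a.
Arguments Dmid {R} m d a.
Arguments D0 {R} m n d a.
Arguments chain {R} d Wm k.
Arguments CE {R} m n Z.
Arguments ufm_loss {R} m n d L WL Wm H.
Arguments grad_WL {R} m n d L WL Wm H p q.
Arguments grad_Wm {R} m n d L WL Wm H l p q.
Arguments grad_H {R} m n d L WL Wm H p q.
Arguments Psi_a {R} m a j.
Arguments bcoef {R} m a i.
Arguments Dden {R} m a.
Arguments e1row {R} n.

(* Main.v *)
Require Import Defs.
From HB Require Import structures.
From mathcomp Require Import all_boot all_order all_algebra.
From mathcomp Require Import all_classical all_reals all_analysis.
From mathcomp Require Import mxtens ring lra zify.
Import Order.TTheory GRing.Theory Num.Theory.
Local Open Scope ring_scope.
Local Open Scope classical_set_scope.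
Import numFieldNormedType.Exports.

Set Implicit Arguments.
Unset Strict Implicit.
Unset Printing Implicit Defensive.

(* Call a state diagonal if it has the form of the initialization.  Two facts
   give the theorem.

   Diagonal states are stable under the gradient.  At such a state the logits of
   a sample of class c are c' |-> sum_b Phi(c',b) Phi(c,b) a_b / (K sqrt n), and
   Phi(c',b) Phi(c,b) = Phi(c' xor c, b); so softmax minus one-hot is a function of
   c' xor c, and the Walsh-Hadamard basis diagonalizes it.  Its eigenvalues are
   - b_i / D.

   The flow cannot leave the diagonal states.  The gradient is locally Lipschitz,
   so the off-diagonal part y of a trajectory satisfies |y'| <= C |y| on compact
   time intervals and y 0 = 0, whence y = 0 by Gronwall; no existence theorem for
   the reduced system is used.

   In the balanced case the conservation laws only give |alpha^(l)_i| equal across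
   layers; the sign needed for the fractional power comes from b_i >= 0, which makes
   the product a_i nondecreasing, hence nonnegative. *)

(** * Sylvester Hadamard matrices *)

Section Hadamard.
Context {R : realType}.

Local Notation had := (@had R).

Lemma had0l m j : had m 0 j = 1.
Proof. by elim: m j => //= m IH j; rewrite expn_gt0 /= !IH; case: ifP. Qed.

Lemma hadC m i j : had m i j = had m j i.
Proof.
elim: m i j => //= m IH i j.
by case: (i < 2 ^ m)%N; case: (j < 2 ^ m)%N; rewrite /= ?(IH i) ?(IH (i - _)%N).
Qed.

Lemma had_sqr m i j : had m i j * had m i j = 1.
Proof.
elim: m i j => [|m IH] i j /=; first by rewrite mulr1.
by do 2 case: ifP => _; rewrite ?mulrNN IH.
Qed.

Lemma had_le1 m i j : had m i j <= 1.
Proof. have := had_sqr m i j; nra. Qed.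

Lemma Psi0l m j : Psi m 0 j = 0 :> R.
Proof. by rewrite /Psi had0l subrr. Qed.

Lemma Psi_ge0 m i j : 0 <= Psi m i j :> R.
Proof. by rewrite subr_ge0 had_le1. Qed.

(** For indices below [2 ^ m] this is bitwise exclusive or. It peels the top binary digit in the
    same order as the block recursion of [had], so the two unfold together. *)
Fixpoint hxor (m i j : nat) : nat :=
  if m is m'.+1 then
    let i' := if (i < 2 ^ m')%N then i else (i - 2 ^ m')%N in
    let j' := if (j < 2 ^ m')%N then j else (j - 2 ^ m')%N in
    if (i < 2 ^ m')%N == (j < 2 ^ m')%N then hxor m' i' j'
    else (2 ^ m' + hxor m' i' j')%N
  else 0.

Lemma hxorC m i j : hxor m i j = hxor m j i.
Proof.
by elim: m i j => //= m IH i j; rewrite eq_sym IH.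
Qed.

Lemma hxor_lt m i j : (hxor m i j < 2 ^ m)%N.
Proof.
elim: m i j => //= m IH i j; rewrite expnS mul2n -addnn.
by case: ifP => _; rewrite ?ltn_add2l ?IH // ltn_addl ?IH.
Qed.

(** The rows of Phi are the characters of (Z/2)^m: a digit contributes a sign exactly when it is set
    in both the row and the column index, and such signs multiply under exclusive or. *)
Lemma had_hxor m i j k : had m (hxor m i j) k = had m i k * had m j k.
Proof.
elim: m i j k => [|m IH] i j k /=; first by rewrite mulr1.
case: (ltnP i) => hi; case: (ltnP j) => hj /=;
  rewrite ?hxor_lt ?ltnNge ?leq_addr /= ?addKn !IH;
  by case: ifP => _; rewrite ?mulrN ?mulNr ?opprK.
Qed.

Lemma hxorK m i j : (j < 2 ^ m)%N -> hxor m i (hxor m i j) = j.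
Proof.
elim: m i j => [|m IH] i j /=; first by rewrite ltnS leqn0 => /eqP.
rewrite expnS mul2n -addnn => hj.
have hj' : (j - 2 ^ m < 2 ^ m)%N by lia.
case: (ltnP i) => hi; case: (ltnP j) => hj2 /=;
  rewrite ?hxor_lt /= ?ltnNge ?leq_addr /= ?addKn ?IH //; lia.
Qed.

Lemma hxor0 m i j : (i < 2 ^ m)%N -> (j < 2 ^ m)%N ->
  (hxor m i j == 0) = (i == j).
Proof.
elim: m i j => [|m IH] i j /=; first by rewrite !ltnS !leqn0 => /eqP-> /eqP->.
rewrite expnS mul2n -addnn => hi hj.
case: (ltnP i) => hi2; case: (ltnP j) => hj2 /=; rewrite ?IH //; try lia;
  rewrite addn_eq0 expn_eq0 /=; lia.
Qed.

(** Induction by halves: the two halves of the column range contribute equal sums when [i] and [j]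
    lie in the same half of the rows, and opposite sums otherwise. *)
Lemma had_orth m i j : (i < 2 ^ m)%N -> (j < 2 ^ m)%N ->
  \sum_(k < 2 ^ m) had m i k * had m j k = (2 ^ m)%:R *+ (i == j).
Proof.
elim: m i j => [|m IH] i j.
  rewrite !ltnS !leqn0 => /eqP-> /eqP->.
  by rewrite big_ord_recl big_ord0 /= mulr1 addr0.
have E (F : nat -> R) :
    \sum_(k < 2 ^ m.+1) F k = \sum_(k < 2 ^ m) F k + \sum_(k < 2 ^ m) F (2 ^ m + k)%N.
  rewrite -(big_mkord xpredT F) (@big_cat_nat _ _ _ (2 ^ m)) //=; last first.
    by rewrite leq_exp2l.
  rewrite big_mkord; congr (_ + _); rewrite -[X in \sum_(X <= _ < _) _]add0n big_addn.
  rewrite expnS mul2n -addnn addnK big_mkord.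
  by apply: eq_bigr => k _; rewrite addnC.
move=> hi hj; rewrite (E (fun k => had m.+1 i k * had m.+1 j k)) /=.
have hi' : ~~ (i < 2 ^ m)%N -> (i - 2 ^ m < 2 ^ m)%N.
  by move: hi; rewrite expnS mul2n -addnn; lia.
have hj' : ~~ (j < 2 ^ m)%N -> (j - 2 ^ m < 2 ^ m)%N.
  by move: hj; rewrite expnS mul2n -addnn; lia.
have B (k : 'I_(2 ^ m)) : ((2 ^ m + k < 2 ^ m) = false)%N.
  by rewrite ltnNge leq_addr.
under [X in X + _ = _]eq_bigr => k _ do rewrite (ltn_ord k).
under [X in _ + X = _]eq_bigr => k _ do rewrite B addKn.
have [Hi|Hi] := boolP (i < 2 ^ m)%N; have [Hj|Hj] := boolP (j < 2 ^ m)%N.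
- by rewrite IH // -mulrnDl -natrD addnn -mul2n -expnS.
- under [X in _ + X = _]eq_bigr do rewrite mulrN.
  rewrite sumrN subrr; suff -> : (i == j) = false by []. lia.
- under [X in _ + X = _]eq_bigr do rewrite mulNr.
  rewrite sumrN subrr; suff -> : (i == j) = false by []. lia.
- under [X in _ + X = _]eq_bigr do rewrite mulrNN.
  rewrite IH ?hi' ?hj' // -mulrnDl -natrD addnn -mul2n -expnS.
  congr (_ *+ nat_of_bool _). lia.
Qed.

Lemma pow2_gt0 m : 0 < (2 ^ m)%:R :> R.
Proof. by rewrite ltr0n expn_gt0. Qed.

Lemma UmxE m i j : @Umx R m i j = (Num.sqrt (2 ^ m)%:R)^-1 * had m i j.
Proof. by rewrite !mxE. Qed.

Lemma trUmx m : (@Umx R m)^T = Umx m.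
Proof. by apply/matrixP => i j; rewrite mxE !UmxE hadC. Qed.

Lemma sqrt_inv_sqr (x : R) : 0 < x -> (Num.sqrt x)^-1 * (Num.sqrt x)^-1 = x^-1.
Proof. by move=> x0; rewrite -invfM -expr2 sqr_sqrtr // ltW. Qed.

Lemma Umx_orth m : (@Umx R m)^T *m Umx m = 1%:M.
Proof.
rewrite trUmx; apply/matrixP => i j; rewrite !mxE.
under eq_bigr => k _ do rewrite !UmxE (hadC m k) mulrACA sqrt_inv_sqr ?pow2_gt0 //.
by rewrite -mulr_sumr had_orth // mulrnAr mulVf ?lt0r_neq0 ?pow2_gt0.
Qed.

(** The columns of V are those of the Kronecker product of U and Q, permuted by the injective
    relabelling [f], and the Gram matrix of a Kronecker product is the product of the Gram
    matrices. *)
Lemma Vmx_orth m n (Q : 'M[R]_n) : Q *m Q^T = 1%:M ->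
  (Vmx m n Q)^T *m Vmx m n Q = 1%:M.
Proof.
move=> /mulmx1C hQ; apply/matrixP => k l.
pose f (k : 'I_(n * 2 ^ m)) :=
  mxtens_index ((mxtens_unindex k).2, (mxtens_unindex k).1).
have fI : injective f.
  move=> x y /(congr1 (@mxtens_unindex _ _)); rewrite !mxtens_indexK => /pair_equal_spec[h1 h2].
  apply: (can_inj (@mxtens_unindexK _ _)).
  by rewrite [LHS]surjective_pairing h2 h1 -surjective_pairing.
transitivity (((Umx m *t Q)^T *m (Umx m *t Q)) (f k) (f l)).
  by rewrite !mxE; apply: eq_bigr => r _; rewrite !mxE.
rewrite trmx_tens tensmx_mul Umx_orth hQ /f; case: (mxtens_unindex k) (mxtens_unindexK k) => a b <-.
case: (mxtens_unindex l) (mxtens_unindexK l) => a' b' <-.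
rewrite /= tensmxE !mxE (can_eq (@mxtens_indexK _ _)) /= xpair_eqE.
by rewrite -natrM mulnb andbC.
Qed.

(** For these columns the column index into Q is 0, and [hQ1] says that the first column of Q is
    constant, equal to 1/sqrt n. *)
Lemma Vmx_first m n (Q : 'M[R]_n) (i : 'I_(2 ^ m)) (s : 'I_n) (k : 'I_(n * 2 ^ m)) :
  const_mx 1 = Num.sqrt (n%:R) *: (e1row n *m Q^T) -> (k < 2 ^ m)%N ->
  Vmx m n Q (mxtens_index (i, s)) k =
    (Num.sqrt (2 ^ m)%:R)^-1 * had m i k * (Num.sqrt n%:R)^-1.
Proof.
move=> hQ1 hk; rewrite mxE.
case: (mxtens_unindex k) (mxtens_unindexK k) => a b kE.
have {}kE : k = (a * 2 ^ m + b)%N :> nat by rewrite -kE.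
have a0 : val a = 0%N.
  apply/eqP; rewrite eqn0Ngt; apply/negP => /leq_mul/(_ (leqnn (2 ^ m)%N)).
  by rewrite mul1n leqNgt (leq_ltn_trans _ hk) // kE leq_addr.
rewrite tensmxE UmxE; congr (_ * had _ _ _ * _).
  by move: kE; rewrite a0.
have := congr1 (fun A : 'rV_n => A 0 s) hQ1; rewrite !mxE.
have n0 : Num.sqrt n%:R != 0 :> R.
  by rewrite gt_eqF // sqrtr_gt0 ltr0n (leq_trans _ (ltn_ord s)).
rewrite (bigD1 a) //= big1 => [|j ja].
  by rewrite !mxE a0 eqxx mul1r addr0 => /esym/(canRL (mulKf n0)) ->; rewrite mulr1.
rewrite !mxE; case: eqP => [j0|_]; last by rewrite mul0r.
by case/negP: ja; apply/eqP/val_inj; rewrite a0.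
Qed.

End Hadamard.

(** * Gradient of the loss *)

Section Gradient.
Context {R : realType}.

Lemma is_derive_bigsum (I : Type) (r : seq I) (P : pred I) (f : I -> R -> R)
    (df : I -> R) (x : R) :
  (forall i, P i -> is_derive x 1 (f i) (df i)) ->
  is_derive x 1 (fun s => \sum_(i <- r | P i) f i s) (\sum_(i <- r | P i) df i).
Proof.
move=> H; elim: r => [|i r IH].
  have -> : (fun s => \sum_(i <- [::] | P i) f i s) = cst 0.
    by apply/funext => s; rewrite big_nil.
  by rewrite big_nil; apply: is_derive_cst.
have -> : (fun s => \sum_(i <- i :: r | P i) f i s) =
   (fun s => (if P i then f i s else 0) + \sum_(i <- r | P i) f i s).
  by apply/funext => s; rewrite big_cons; case: ifP; rewrite ?add0r.
rewrite big_cons; case: ifP => Pi; first exact: is_deriveD (H _ Pi) IH.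
under eq_fun do rewrite add0r. by [].
Qed.

Lemma is_derive_affine (z y x : R) : is_derive x 1 (fun s : R => z + s * y) y.
Proof.
have := is_deriveD (is_derive_cst z x 1) (is_deriveM (is_derive_id x 1) (is_derive_cst y x 1)).
by rewrite scaler0 !add0r /GRing.scale /= mulr1.
Qed.

Definition softmax (p q : nat) (Z : 'M[R]_(p, q)) : 'M[R]_(p, q) :=
  \matrix_(i, j) (expR (Z i j) / \sum_(k < p) expR (Z k j)).

Lemma sum_expR_gt0 (p : nat) (z : 'I_p -> R) (i : 'I_p) : 0 < \sum_k expR (z k).
Proof.
rewrite (bigD1 i) //= ltr_pwDl ?expR_gt0 //.
by apply: sumr_ge0 => k _; rewrite expR_ge0.
Qed.

Lemma CE_E (m n : nat) (Z : 'M[R]_(2 ^ m, 2 ^ m * n)) :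
  CE m n Z = \sum_(c < 2 ^ m) \sum_(s < n)
    (ln (\sum_k expR (Z k (mxtens_index (c, s)))) - Z c (mxtens_index (c, s))).
Proof.
rewrite /CE -sumrN; apply: eq_bigr => c _; rewrite -sumrN; apply: eq_bigr => s _.
by rewrite ln_div ?posrE ?expR_gt0 ?(sum_expR_gt0 _ c) // expRK opprB.
Qed.

(** Softmax minus the one-hot label matrix, which is the gradient of the loss in the logits;
    [(mxtens_unindex j).1] is the class of column [j]. *)
Definition gradZ (m n : nat) (Z : 'M[R]_(2 ^ m, 2 ^ m * n)) : 'M[R]_(2 ^ m, 2 ^ m * n) :=
  \matrix_(i, j) (softmax Z i j - (i == (mxtens_unindex j).1)%:R).

Lemma sum_mxtens (p q : nat) (F : 'I_(p * q) -> R) :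
  \sum_j F j = \sum_c \sum_s F (mxtens_index (c, s)).
Proof.
rewrite pair_bigA /= (reindex (@mxtens_index p q)) /=.
  by apply: eq_bigr => -[].
exists (@mxtens_unindex p q) => x _; [exact: mxtens_indexK|exact: mxtens_unindexK].
Qed.

Lemma is_derive_CE (m n : nat) (Z M : 'M[R]_(2 ^ m, 2 ^ m * n)) :
  is_derive (0 : R) 1 (fun s : R => CE m n (Z + s *: M))
    (\sum_j \sum_i gradZ Z i j * M i j).
Proof.
under eq_fun do rewrite CE_E.
rewrite sum_mxtens; apply: is_derive_bigsum => c _; apply: is_derive_bigsum => s _.
set j := mxtens_index _.
have E i (x : R) : is_derive x 1 (fun s : R => (Z + s *: M) i j) (M i j).
  by under eq_fun do rewrite !mxE; exact: is_derive_affine.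
have D : is_derive (0 : R) 1 (fun s : R => \sum_k expR ((Z + s *: M) k j))
    (\sum_k expR (Z k j) * M k j).
  apply: is_derive_bigsum => k _.
  have := is_derive1_comp (is_derive_expR ((Z + 0 *: M) k j)) (E k 0).
  by rewrite scale0r addr0.
have S0 := sum_expR_gt0 (fun k => Z k j) c.
have S0' : 0 < \sum_k expR ((Z + (0 : R) *: M) k j) by rewrite scale0r addr0.
have := is_deriveB (is_derive1_comp (is_derive1_ln S0') D) (E c 0).
move=> /is_derive_eq; apply.
rewrite scale0r addr0 mulr_sumr.
under [RHS]eq_bigr => k _ do rewrite !mxE mxtens_indexK /= mulrBl.
rewrite sumrB; congr (_ - _); first by apply: eq_bigr => k _; rewrite mulrA [_^-1 * _]mulrC.
rewrite (bigD1 c) //= eqxx mul1r big1 ?addr0 // => k /negPf ->.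
by rewrite mul0r.
Qed.

(** Adjunction for the Frobenius pairing: moving [A] and [B] to the other side transposes them, and
    pairing with an elementary matrix reads off one entry. *)
Lemma sum_mul_delta (a b p q : nat) (G : 'M[R]_(a, b)) (A : 'M[R]_(a, p)) (B : 'M[R]_(q, b)) x y :
  \sum_j \sum_i G i j * (A *m delta_mx x y *m B) i j = (A^T *m G *m B^T) x y.
Proof.
rewrite mxE; apply: eq_bigr => j _; rewrite !mxE mulr_suml; apply: eq_bigr => i _.
rewrite !mxE (bigD1 y) //= big1 ?addr0 => [|k ky].
  rewrite mxE (bigD1 x) //= big1 ?addr0 => [|k kx]; last by rewrite !mxE (negPf kx) mulr0.
  by rewrite !mxE !eqxx mulr1; ring.
by rewrite mxE big1 ?mul0r // => l _; rewrite mxE (negPf ky) andbF mulr0.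
Qed.

(** Each weight matrix enters the logits as A W B with A and B independent of it, so the gradients
    for all three kinds of layer are instances of this formula. *)
Lemma derive1_CE_affine (m n p q : nat) (f : R -> 'M[R]_(2 ^ m, 2 ^ m * n))
    (Z : 'M[R]_(2 ^ m, 2 ^ m * n)) (A : 'M[R]_(2 ^ m, p)) (B : 'M[R]_(q, 2 ^ m * n)) x y :
  (forall s, f s = Z + s *: (A *m delta_mx x y *m B)) ->
  derive1 (fun s => CE m n (f s)) 0 = (A^T *m gradZ Z *m B^T) x y.
Proof.
move=> fE; under eq_fun do rewrite fE.
by rewrite derive1E; have /(@derive_val _ _ _ _ _ _ _) -> := is_derive_CE Z (A *m delta_mx x y *m B);
  rewrite sum_mul_delta.
Qed.

(* [uchain d W k l] is the product [W_k ... W_(l+1)] of the factors above layer [l]. *)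
Fixpoint uchain (d : nat) (Wm : nat -> 'M[R]_d) (k l : nat) : 'M[R]_d :=
  if k is k'.+1 then
    if (k' < l)%N then 1%:M else Wm k'.+1 *m uchain Wm k' l
  else 1%:M.

Lemma chain_upd (d : nat) (Wm : nat -> 'M[R]_d) (E : 'M[R]_d) (k l : nat) : (0 < l)%N ->
  chain d (fun j => if j == l then Wm j + E else Wm j) k =
  if (l <= k)%N then chain d Wm k + uchain Wm k l *m E *m chain d Wm l.-1
  else chain d Wm k.
Proof.
move=> l0; elim: k => [|k IH] /=; first by rewrite leqNgt l0.
rewrite IH; case: (ltngtP l k.+1) => [lk|lk|->] /=.
- have -> : (l <= k)%N by [].
  by rewrite mulmxDr !mulmxA.
- by rewrite leqNgt ltnW.
- by rewrite ltnn mul1mx mulmxDl.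
Qed.

Variables (m n d L : nat) (WL : 'M[R]_(2 ^ m, d)) (Wm : nat -> 'M[R]_d)
  (H : 'M[R]_(d, 2 ^ m * n)).
Let G := gradZ (WL *m chain d Wm L.-1 *m H).

Lemma grad_WLE p q : grad_WL m n d L WL Wm H p q =
  (G *m (chain d Wm L.-1 *m H)^T) p q.
Proof.
(* The top layer has nothing to its left, so an identity is inserted to play the role of [A]. *)
rewrite -[G]mul1mx -trmx1 -mulmxA mulmxA; apply: derive1_CE_affine => s.
by rewrite mul1mx mulmxDl mulmxDl -!scalemxAl !mulmxA.
Qed.

Lemma grad_HE p q : grad_H m n d L WL Wm H p q =
  ((WL *m chain d Wm L.-1)^T *m G) p q.
Proof.
rewrite -[_ *m G]mulmx1 -trmx1; apply: derive1_CE_affine => s.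
by rewrite mulmx1 mulmxDr scalemxAr.
Qed.

Lemma grad_WmE l p q : (1 <= l <= L.-1)%N -> grad_Wm m n d L WL Wm H l p q =
  ((WL *m uchain Wm L.-1 l)^T *m G *m (chain d Wm l.-1 *m H)^T) p q.
Proof.
case/andP=> l0 lL; apply: derive1_CE_affine => s.
rewrite (chain_upd _ _ _ l0) lL mulmxDr mulmxDl; congr (_ + _).
by rewrite -scalemxAr -scalemxAl -!scalemxAr -!scalemxAl !mulmxA.
Qed.

End Gradient.

(** * Walsh-Hadamard diagonalization of the softmax residual *)

Section Diagonal.
Context {R : realType}.
Implicit Types a b : nat -> R.

(** One encoding for the factors of all three shapes. The diagonal is a sequence on [nat], so
    products of different shapes just multiply sequences pointwise. *)
Definition rdiag p q a : 'M[R]_(p, q) :=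
  \matrix_(i, j) (if i == j :> nat then a i else 0).

Lemma eq_rdiag p q a b :
  (forall i, (i < p)%N -> (i < q)%N -> a i = b i) -> rdiag p q a = rdiag p q b.
Proof.
move=> ab; apply/matrixP => i j; rewrite !mxE; case: eqP => // ij.
by rewrite ab // ij.
Qed.

Lemma tr_rdiag p q a : (rdiag p q a)^T = rdiag q p a.
Proof. by apply/matrixP => i j; rewrite !mxE eq_sym; case: eqP => // ->. Qed.

Lemma rdiag1 p : rdiag p p (fun=> 1) = 1%:M.
Proof. by apply/matrixP => i j; rewrite !mxE val_eqE; case: eqP. Qed.

(** If the inner dimension [q] is the smallest, the product has zero diagonal from position [q] on;
    the side condition makes the pointwise product agree there. *)
Lemma rdiag_mul p q r a b :
  (forall i, (i < p)%N -> (i < r)%N -> (q <= i)%N -> a i * b i = 0) ->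
  rdiag p q a *m rdiag q r b = rdiag p r (fun i => a i * b i).
Proof.
move=> ab; apply/matrixP => i j; rewrite !mxE.
have [iq|iq] := ltnP i q.
  rewrite (bigD1 (Ordinal iq)) //= big1 ?addr0 => [|k ki].
    by rewrite !mxE eqxx /=; case: ifP; rewrite ?mulr0.
  rewrite !mxE; case: eqP => [ik|_]; last by rewrite mul0r.
  by case/negP: ki; apply/eqP/val_inj.
rewrite big1 => [|k _].
  by case: eqP => // ij; rewrite ab // ij.
by rewrite !mxE; case: eqP => [ik|_]; rewrite ?mul0r // leqNgt ik ltn_ord in iq *.
Qed.

Lemma rdiagN p q a : - rdiag p q a = rdiag p q (fun i => - a i).
Proof. by apply/matrixP => i j; rewrite !mxE; case: eqP; rewrite ?oppr0. Qed.

(** The [i]-th diagonal entry, written as a double sum so that [i] may be any natural number (the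
    value is 0 out of range) and linearity is visible: derivatives, continuity and Lipschitz bounds
    pass through finite sums. *)
Definition dgl p q (A : 'M[R]_(p, q)) (i : nat) : R :=
  \sum_(x < p) \sum_(y < q) (if (x == i :> nat) && (y == i :> nat) then A x y else 0).

Lemma dgl_rdiag p q a i : (i < p)%N -> (i < q)%N -> dgl (rdiag p q a) i = a i.
Proof.
move=> ip iq; rewrite /dgl (bigD1 (Ordinal ip)) //= [X in _ + X]big1 ?addr0 => [|x xi].
  rewrite (bigD1 (Ordinal iq)) //= big1 ?addr0 => [|y yi].
    by rewrite mxE /= eqxx.
  case: ifP => // /andP[_ /eqP h]; case/negP: yi; exact/eqP/val_inj.
rewrite big1 // => y _; case: ifP => // /andP[/eqP h _].
case/negP: xi; exact/eqP/val_inj.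
Qed.

(** Eigenvalue of the softmax residual on the [i]-th Walsh-Hadamard mode. *)
Definition lam m a i : R := - (bcoef m a i / Dden m a).

Lemma Dden_gt0 m a : 0 < Dden m a.
Proof.
by rewrite /Dden ltr_pwDl // sumr_ge0 // => i _; rewrite expR_ge0.
Qed.

Lemma bcoef_ge0 m a i : 0 <= bcoef m a i.
Proof.
by rewrite sumr_ge0 // => j _; rewrite mulr_ge0 ?expR_ge0 // Psi_ge0.
Qed.

Lemma sum_from1 m (F : nat -> R) :
  \sum_(k < 2 ^ m) F k = F 0%N + \sum_(1 <= k < 2 ^ m) F k.
Proof. by rewrite -(big_mkord xpredT F) big_ltn ?expn_gt0. Qed.

(** The terms with k = 0 cancel because the first column of Phi is constant. Thus (Psi a)_j is the
    gap between the logit of the true class and the logit at exclusive-or distance [j] from it. *)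
Lemma Psi_aE m a j : (j < 2 ^ m)%N ->
  Psi_a m a j = \sum_(k < 2 ^ m) had m 0 k * a k - \sum_(k < 2 ^ m) had m j k * a k.
Proof.
move=> jm; rewrite -sumrB (sum_from1 m (fun k => had m 0 k * a k - had m j k * a k)).
rewrite had0l (hadC m j) had0l subrr add0r.
by apply: eq_bigr => k _; rewrite had0l /Psi mulrBl.
Qed.

Lemma Psi_a0 m a : Psi_a m a 0 = 0.
Proof. by rewrite /Psi_a big1 // => k _; rewrite Psi0l mul0r. Qed.

Lemma DdenE m a : Dden m a = \sum_(j < 2 ^ m) expR (- Psi_a m a j).
Proof.
by rewrite (sum_from1 m (fun j => expR (- Psi_a m a j))) Psi_a0 oppr0 expR0.
Qed.

Lemma bcoefE m a i :
  bcoef m a i = Dden m a - \sum_(j < 2 ^ m) had m i j * expR (- Psi_a m a j).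
Proof.
rewrite DdenE -sumrB /bcoef.
rewrite (sum_from1 m (fun j => expR (- Psi_a m a j) - had m i j * expR (- Psi_a m a j))).
rewrite (hadC m i) had0l mul1r subrr add0r; apply: eq_bigr => j _.
by rewrite /Psi mulrBl mul1r.
Qed.

Lemma bcoef0 m a : bcoef m a 0 = 0.
Proof. by rewrite /bcoef big1 // => k _; rewrite Psi0l mul0r. Qed.

Lemma lam0 m a : lam m a 0 = 0.
Proof. by rewrite /lam bcoef0 mul0r oppr0. Qed.

(* Walsh-Hadamard inversion of the eigenvalues [lam]. *)
Lemma lam_inv m a y : (y < 2 ^ m)%N ->
  \sum_(b < 2 ^ m) had m y b * (lam m a b / (2 ^ m)%:R) =
  expR (- Psi_a m a y) / Dden m a - (y == 0%N)%:R.
Proof.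
move=> ym; have D0 := lt0r_neq0 (Dden_gt0 m a).
have K0 := lt0r_neq0 (@pow2_gt0 R m).
(* Both parts of [lam] become Walsh sums against row [y]: by orthogonality of rows, the exponentials
   select j = y and the constant row 0 yields the one-hot term. *)
have E (b : 'I_(2 ^ m)) : had m y b * (lam m a b / (2 ^ m)%:R) =
  (2 ^ m)%:R^-1 * (\sum_(j < 2 ^ m)
     (had m y b * had m j b) * (expR (- Psi_a m a j) / Dden m a)
     - had m y b * had m 0 b).
  under eq_bigr => j _ do rewrite -mulrA (hadC m j) [had m b j * _]mulrA.
  rewrite -mulr_sumr -mulr_suml had0l /lam bcoefE; field.
  by rewrite D0 K0.
under eq_bigr => b _ do rewrite E.
rewrite -mulr_sumr sumrB exchange_big /=.
under eq_bigr => j _ do rewrite -mulr_suml had_orth //.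
rewrite (bigD1 (Ordinal ym)) //= eqxx big1 ?addr0 => [|j jy]; last first.
  rewrite (_ : (y == j) = false) ?mul0r //; apply/negP => /eqP h.
  by case/negP: jy; apply/eqP/val_inj.
rewrite had_orth ?expn_gt0 // mulrBr; congr (_ - _).
  by rewrite mulr1n mulKf.
by rewrite mulrnAr mulVf.
Qed.

Variables (m n d : nat) (Q : 'M[R]_n).
Hypotheses (n0 : (0 < n)%N).
Hypothesis hQ1 : const_mx 1 = Num.sqrt (n%:R) *: (e1row n *m Q^T).

Local Notation K := (2 ^ m)%N.
Local Notation V := (Vmx m n Q).
Local Notation Ksn := ((2 ^ m)%:R * Num.sqrt n%:R).

Lemma sqrtn_gt0 : 0 < Num.sqrt n%:R :> R.
Proof. by rewrite sqrtr_gt0 ltr0n. Qed.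

(** Only the first K columns of V meet the diagonal. There U and V each contribute 1/sqrt K, V a
    further 1/sqrt n, and [had_hxor] merges the two signs into one. *)
Lemma UrdiagVE a (i c : 'I_K) (s : 'I_n) :
  (Umx m *m rdiag K (n * K) a *m V^T) i (mxtens_index (c, s)) =
  \sum_(b < K) had m (hxor m i c) b * (a b / Ksn).
Proof.
have nK : (K <= n * K)%N by rewrite leq_pmull.
rewrite -mulmxA mxE; apply: eq_bigr => b _.
rewrite [(_ *m V^T) _ _]mxE (bigD1 (widen_ord nK b)) //= big1 ?addr0 => [|k kb]; last first.
  rewrite mxE; case: eqP => [bk|]; rewrite ?mul0r //.
  by case/negP: kb; apply/eqP/val_inj.
rewrite [rdiag _ _ _ _ _]mxE eqxx [V^T _ _]mxE Vmx_first //= UmxE had_hxor invfM.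
rewrite -(sqrt_inv_sqr (@pow2_gt0 R m)); ring.
Qed.

Lemma gradZ_diag a :
  gradZ (Umx m *m rdiag K (n * K) a *m V^T) =
  Umx m *m rdiag K (n * K)
    (fun i => Num.sqrt n%:R * lam m (fun k => a k / Ksn) i) *m V^T.
Proof.
apply/matrixP => i j; case: (mxtens_indexP j) => {j} c s.
have s0 := lt0r_neq0 sqrtn_gt0.
have K0 := lt0r_neq0 (@pow2_gt0 R m).
rewrite [RHS]UrdiagVE [LHS]mxE [softmax _ _ _]mxE mxtens_indexK /=.
set a' := fun k => a k / Ksn.
(* The logit of row 0, which is that of the true class, is factored out; it cancels between
   numerator and denominator of the softmax. *)
have E (k : 'I_K) : expR ((Umx m *m rdiag K (n * K) a *m V^T) k (mxtens_index (c, s)))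
   = expR (\sum_(b < K) had m 0 b * a' b) * expR (- Psi_a m a' (hxor m k c)).
  by rewrite UrdiagVE -expRD Psi_aE ?hxor_lt // opprB addrC subrK.
under [in LHS]eq_bigr => k _ do rewrite E.
rewrite E -mulr_sumr -mulf_div divff ?mul1r ?lt0r_neq0 ?expR_gt0 //.
transitivity (\sum_(b < K) had m (hxor m i c) b * (lam m a' b / K%:R)).
  rewrite lam_inv ?hxor_lt // hxor0 // DdenE; congr (_ / _ - _).
  (* Exclusive or with [c] permutes the classes, so the softmax denominator is the same for every
     class and equals [Dden]. *)
  pose f (k : 'I_K) : 'I_K := Ordinal (hxor_lt m c k).
  have fK : involutive f by move=> k; apply/val_inj; rewrite /= hxorK.
  rewrite (reindex_inj (inv_inj fK)) /=; apply: eq_bigr => k _.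
  by rewrite hxorC hxorK.
by apply: eq_bigr => b _; congr (_ * _); field; rewrite s0 K0.
Qed.

End Diagonal.

(** * Lipschitz estimates and Gronwall's inequality *)

Section LipschitzCongruence.
Context {R : realType} {X : Type} (A : set X) (N : X -> R).

(* [f] and [g] are bounded and differ by [O(N)] on [A]; this congruence replaces
   the local Lipschitz estimates of the vector field. *)
Definition lipeq (f g : X -> R) :=
  (exists B, forall t, A t -> `|f t| <= B /\ `|g t| <= B) /\
  (exists C, forall t, A t -> `|f t - g t| <= C * N t).

Lemma lipeq_cst c : lipeq (fun=> c) (fun=> c).
Proof.
split; first by exists `|c|.
by exists 0 => t At; rewrite subrr normr0 mul0r.
Qed.

Lemma lipeqD f g f' g' : lipeq f g -> lipeq f' g' ->
  lipeq (fun t => f t + f' t) (fun t => g t + g' t).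
Proof.
move=> [[B hB] [C hC]] [[B' hB'] [C' hC']]; split.
  exists (B + B') => t At; have [h1 h2] := hB t At; have [h3 h4] := hB' t At.
  by split; apply: le_trans (ler_normD _ _) _; apply: lerD.
exists (C + C') => t At; rewrite mulrDl opprD addrACA.
by apply: le_trans (ler_normD _ _) _; apply: lerD; auto.
Qed.

(** Here the boundedness carried by [lipeq] is used: a product of Lipschitz quantities is Lipschitz
    only where both are bounded. *)
Lemma lipeqM f g f' g' : lipeq f g -> lipeq f' g' ->
  lipeq (fun t => f t * f' t) (fun t => g t * g' t).
Proof.
move=> [[B hB] [C hC]] [[B' hB'] [C' hC']]; split.
  exists (B * B') => t At; have [h1 h2] := hB t At; have [h3 h4] := hB' t At.
  by split; rewrite normrM; apply: ler_pM.
exists (B * C' + B' * C) => t At.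
have [h1 h2] := hB t At; have [h3 h4] := hB' t At.
have -> : f t * f' t - g t * g' t = f t * (f' t - g' t) + g' t * (f t - g t) by ring.
apply: le_trans (ler_normD _ _) _; rewrite mulrDl -!mulrA !normrM.
by apply: lerD; apply: ler_pM; auto.
Qed.

Lemma lipeqN f g : lipeq f g -> lipeq (fun t => - f t) (fun t => - g t).
Proof.
move=> [[B hB] [C hC]]; split; first by exists B => t; rewrite !normrN; auto.
by exists C => t At; rewrite -opprD normrN; auto.
Qed.

Lemma lipeq_sum (I : Type) (r : seq I) (P : pred I) (f g : I -> X -> R) :
  (forall i, P i -> lipeq (f i) (g i)) ->
  lipeq (fun t => \sum_(i <- r | P i) f i t) (fun t => \sum_(i <- r | P i) g i t).
Proof.
move=> H; elim: r => [|i r IH].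
  by under [X in lipeq X _]eq_fun do rewrite big_nil;
    under [X in lipeq _ X]eq_fun do rewrite big_nil; exact: lipeq_cst.
under [X in lipeq X _]eq_fun do rewrite big_cons.
under [X in lipeq _ X]eq_fun do rewrite big_cons.
by have := H i; case: (P i) => // Hi; apply: lipeqD => //; exact: Hi.
Qed.

Lemma expR_lip (x y B : R) : `|x| <= B -> `|y| <= B ->
  `|expR x - expR y| <= expR B * `|x - y|.
Proof.
(* One-sided bound from the tangent inequality 1 + x <= exp x at x = v - u; exchanging the arguments
   gives the other side. *)
have half u v : `|u| <= B -> expR u - expR v <= expR B * `|u - v|.
  move=> hu; apply: (@le_trans _ _ (expR u * (u - v))).
    have := expR_ge1Dx (v - u).
    move=> /(ler_wpM2l (expR_ge0 u)); rewrite -expRD (addrC u (v - u)) subrK => h; lra.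
  apply: (@le_trans _ _ (expR u * `|u - v|)).
    by rewrite ler_wpM2l ?expR_ge0 ?ler_norm.
  by rewrite ler_wpM2r // ler_expR (le_trans (ler_norm _)).
move=> hx hy; rewrite ler_norml; apply/andP; split; last exact: half.
by rewrite lerNl opprB distrC half.
Qed.

Lemma lipeq_expR f g : lipeq f g -> lipeq (fun t => expR (f t)) (fun t => expR (g t)).
Proof.
move=> [[B hB] [C hC]]; split.
  exists (expR B) => t At; have [h1 h2] := hB t At.
  by split; rewrite ger0_norm ?expR_ge0 // ler_expR; apply: le_trans (ler_norm _) _.
exists (expR B * C) => t At; have [h1 h2] := hB t At.
apply: le_trans (expR_lip h1 h2) _.
by rewrite -mulrA ler_wpM2l ?expR_ge0 //; auto.
Qed.

Lemma lipeqV f g e : 0 < e -> (forall t, A t -> e <= f t /\ e <= g t) ->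
  lipeq f g -> lipeq (fun t => (f t)^-1) (fun t => (g t)^-1).
Proof.
move=> e0 he [[B hB] [C hC]]; split.
  exists e^-1 => t At; have [h1 h2] := he t At.
  have f0 := lt_le_trans e0 h1; have g0 := lt_le_trans e0 h2.
  by split; rewrite ger0_norm ?invr_ge0 ?(ltW f0) ?(ltW g0) // lef_pV2.
exists (e^-1 * e^-1 * C) => t At; have [h1 h2] := he t At.
have f0 := lt_le_trans e0 h1; have g0 := lt_le_trans e0 h2.
have -> : (f t)^-1 - (g t)^-1 = (f t)^-1 * (g t)^-1 * - (f t - g t).
  by field; rewrite !gt_eqF.
rewrite normrM normrN -[leRHS]mulrA; apply: ler_pM => //; last exact: hC.
have [f0' g0'] := (ltW f0, ltW g0).
by rewrite ger0_norm ?mulr_ge0 ?invr_ge0 // ler_pM ?invr_ge0 ?lef_pV2 ?posrE.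
Qed.

Definition mlipeq p q (F G : X -> 'M[R]_(p, q)) :=
  forall i j, lipeq (fun t => F t i j) (fun t => G t i j).

Lemma mlipeq_cst p q (M : 'M[R]_(p, q)) : mlipeq (fun=> M) (fun=> M).
Proof. by move=> i j; apply: lipeq_cst. Qed.

Lemma mlipeq_mul p q r (F G : X -> 'M[R]_(p, q)) (F' G' : X -> 'M[R]_(q, r)) :
  mlipeq F G -> mlipeq F' G' ->
  mlipeq (fun t => F t *m F' t) (fun t => G t *m G' t).
Proof.
move=> H H' i j; under [X in lipeq X _]eq_fun do rewrite mxE.
under [X in lipeq _ X]eq_fun do rewrite mxE.
by apply: lipeq_sum => k _; apply: lipeqM.
Qed.

Lemma mlipeq_tr p q (F G : X -> 'M[R]_(p, q)) :
  mlipeq F G -> mlipeq (fun t => (F t)^T) (fun t => (G t)^T).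
Proof.
move=> H i j; under [X in lipeq X _]eq_fun do rewrite mxE.
by under [X in lipeq _ X]eq_fun do rewrite mxE.
Qed.

Lemma lipeq_dgl p q (F G : X -> 'M[R]_(p, q)) i :
  mlipeq F G -> lipeq (fun t => dgl (F t) i) (fun t => dgl (G t) i).
Proof.
move=> H; apply: lipeq_sum => x _; apply: lipeq_sum => y _.
by case: (_ && _); [exact: H|exact: lipeq_cst].
Qed.

Lemma mlipeq_rdiag p q (f g : X -> nat -> R) :
  (forall i, lipeq (f^~ i) (g^~ i)) ->
  mlipeq (fun t => rdiag p q (f t)) (fun t => rdiag p q (g t)).
Proof.
move=> H i j; under [X in lipeq X _]eq_fun do rewrite mxE.
under [X in lipeq _ X]eq_fun do rewrite mxE.
by case: (_ == _); [exact: H|exact: lipeq_cst].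
Qed.

(** Division is harmless because the softmax denominator stays away from 0: it exceeds its own
    [i]-th term, which is at least exp(-B) when the logit is bounded by [B]. *)
Lemma mlipeq_gradZ m n (F G : X -> 'M[R]_(2 ^ m, 2 ^ m * n)) :
  mlipeq F G -> mlipeq (fun t => gradZ (F t)) (fun t => gradZ (G t)).
Proof.
move=> H i j; under [X in lipeq X _]eq_fun do rewrite !mxE.
under [X in lipeq _ X]eq_fun do rewrite !mxE.
apply: lipeqD; last exact: lipeq_cst.
apply: lipeqM; first exact: lipeq_expR.
have [[B hB] _] := H i j.
apply: (@lipeqV _ _ (expR (- B))); first exact: expR_gt0; last first.
  by apply: lipeq_sum => k _; apply: lipeq_expR.
move=> t At; have [h1 h2] := hB t At.
have E (Z : 'M[R]_(2 ^ m, 2 ^ m * n)) : `|Z i j| <= B ->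
    expR (- B) <= \sum_k expR (Z k j).
  rewrite ler_norml => /andP[h _]; rewrite (bigD1 i) //=.
  rewrite -[leLHS]addr0 lerD ?ler_expR // sumr_ge0 // => k _; exact: expR_ge0.
by split; apply: E.
Qed.

Lemma mlipeq_chain d (F G : X -> nat -> 'M[R]_d) k :
  (forall l, (1 <= l <= k)%N -> mlipeq (F^~ l) (G^~ l)) ->
  mlipeq (fun t => chain d (F t) k) (fun t => chain d (G t) k).
Proof.
elim: k => [|k IH] H /=; first exact: mlipeq_cst.
apply: mlipeq_mul; first by apply: H; rewrite leqnn.
by apply: IH => l /andP[l1 l2]; apply: H; rewrite l1 leqW.
Qed.

Lemma mlipeq_uchain d (F G : X -> nat -> 'M[R]_d) k j :
  (forall l, (1 <= l <= k)%N -> mlipeq (F^~ l) (G^~ l)) ->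
  mlipeq (fun t => uchain (F t) k j) (fun t => uchain (G t) k j).
Proof.
elim: k => [|k IH] H /=; first exact: mlipeq_cst.
case: (k < j)%N; first exact: mlipeq_cst.
apply: mlipeq_mul; first by apply: H; rewrite leqnn.
by apply: IH => l /andP[l1 l2]; apply: H; rewrite l1 leqW.
Qed.

End LipschitzCongruence.

(** * Continuity on intervals and Gronwall's inequality for finite families *)

Section Calculus.
Context {R : realType}.

Lemma within_continuous_sum (A : set R) (I : Type) (r : seq I) (P : pred I)
    (f : I -> R -> R) :
  (forall i, P i -> {within A, continuous (f i)}) ->
  {within A, continuous (fun s => \sum_(i <- r | P i) f i s)}.
Proof.
move=> H; elim: r => [|i r IH].
  under eq_fun do rewrite big_nil; move=> x; exact: cst_continuous.
under eq_fun do rewrite big_cons; have := H i; case: (P i) => // Hi x.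
by apply: continuousD; [exact: Hi|exact: IH].
Qed.

Lemma within_continuousM (A : set R) (f g : R -> R) :
  {within A, continuous f} -> {within A, continuous g} ->
  {within A, continuous (fun s => f s * g s)}.
Proof. by move=> hf hg x; apply: continuousM; [exact: hf|exact: hg]. Qed.

Lemma within_continuousB (A : set R) (f g : R -> R) :
  {within A, continuous f} -> {within A, continuous g} ->
  {within A, continuous (fun s => f s - g s)}.
Proof. by move=> hf hg x; apply: continuousB; [exact: hf|exact: hg]. Qed.

Lemma within_continuous_cst (A : set R) (c : R) :
  {within A, continuous (fun _ : R => c)}.
Proof. by move=> x; exact: cst_continuous. Qed.

Lemma is_deriveMfun (f g : R -> R) (x df dg : R) :
  is_derive x 1 f df -> is_derive x 1 g dg ->
  is_derive x 1 (fun s => f s * g s) (f x * dg + g x * df).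
Proof. by move=> hf hg; exact: is_deriveM hf hg. Qed.

Lemma within_bounded (f : R -> R) (a b : R) : a <= b ->
  {within `[a, b], continuous f} -> exists B, forall t, a <= t <= b -> `|f t| <= B.
Proof.
move=> ab cf.
have cf' : {within `[a, b], continuous (fun t => `|f t|)}.
  by move=> x; apply: continuous_comp; [exact: cf|exact: norm_continuous].
have [c _ hc] := EVT_max ab cf'; exists `|f c| => t; exact: hc.
Qed.

(** The energy E, the sum of the squares of the components, satisfies E' <= M E, so E(t) exp(-M t)
    is nonincreasing; it starts at 0 and is nonnegative. *)
Lemma gronwall_eq0 (I : finType) (y dy : I -> R -> R) (T C : R) : 0 <= T ->
  (forall i, {within `[0, T], continuous (y i)}) ->
  (forall i, y i 0 = 0) ->
  (forall i t, 0 < t < T -> is_derive t 1 (y i) (dy i t)) ->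
  (forall i t, 0 < t < T -> `|dy i t| <= C * \sum_j `|y j t|) ->
  forall i t, 0 <= t <= T -> y i t = 0.
Proof.
move=> T0 cy y0 dyE ydy.
pose E t := \sum_i y i t * y i t.
(* The factor 2 comes from differentiating squares and the cardinality from [S2]; the absolute value
   is there because [C] may be negative. *)
pose M := 2 * `|C| * #|I|%:R.
have dE t : 0 < t < T -> is_derive t 1 E (\sum_i (y i t * dy i t + y i t * dy i t)).
  by move=> ht; apply: is_derive_bigsum => i _; apply: is_deriveMfun; exact: dyE.
pose g t := E t * expR (t * - M).
have dg t : 0 < t < T -> is_derive t 1 g
   (E t * (expR (t * - M) * - M) + expR (t * - M) * \sum_i (y i t * dy i t + y i t * dy i t)).
  move=> ht; apply: is_deriveMfun; first exact: dE.
  have := is_derive_affine 0 (- M) t; under eq_fun do rewrite add0r; move=> h.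
  exact: is_derive1_comp (is_derive_expR _) h.
have E0 t : 0 <= E t by apply: sumr_ge0 => i _; rewrite -expr2 sqr_ge0.
(* Cauchy-Schwarz in the form |u v| <= (u^2 + v^2)/2, summed over all pairs. *)
have S2 t : (\sum_j `|y j t|) * (\sum_j `|y j t|) <= #|I|%:R * E t.
  apply: (@le_trans _ _ (\sum_i \sum_j (y i t * y i t + y j t * y j t) / 2)).
    rewrite mulr_suml; apply: ler_sum => i _; rewrite mulr_sumr; apply: ler_sum => j _.
    have := sqr_ge0 (y i t - y j t); have := sqr_ge0 (y i t + y j t).
    by rewrite -normrM ler_norml !expr2 => h1 h2; apply/andP; split; lra.
  under eq_bigr => i _ do rewrite -mulr_suml big_split /= sumr_const.
  rewrite -mulr_suml big_split /= sumr_const !sumrMnl -/(E t).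
  by rewrite -mulr_natl; lra.
have le0 t : 0 < t < T -> E t * (expR (t * - M) * - M) +
    expR (t * - M) * (\sum_i (y i t * dy i t + y i t * dy i t)) <= 0.
  move=> ht.
  have h : \sum_i (y i t * dy i t + y i t * dy i t) <= M * E t.
    apply: (@le_trans _ _ (2 * `|C| * ((\sum_j `|y j t|) * (\sum_j `|y j t|)))).
      rewrite [X in _ * X]mulr_suml mulr_sumr; apply: ler_sum => i _.
      have h1 : y i t * dy i t <= `|y i t| * `|dy i t| by rewrite -normrM ler_norm.
      have h2 : `|y i t| * `|dy i t| <= `|y i t| * (`|C| * \sum_j `|y j t|).
        rewrite ler_wpM2l // (le_trans (ydy i t ht)) // ler_wpM2r ?ler_norm //.
        exact: sumr_ge0.
      lra.
    by rewrite /M -!mulrA ler_wpM2l // ler_wpM2l.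
  by have := expR_gt0 (t * - M); nra.
have cg : {within `[0, T], continuous g}.
  apply: within_continuousM.
    by apply: within_continuous_sum => i _; apply: within_continuousM.
  apply: continuous_subspaceT => x; apply: continuous_comp; last exact: continuous_expR.
  by apply: continuousM; [exact: cvg_id|exact: cvg_cst].
have g0 : g 0 = 0.
  by rewrite /g /E big1 ?mul0r // => i _; rewrite y0 mulr0.
move=> i t /andP[t0 tT].
have : g t <= g 0.
  apply: (ler0_derive1_le_cc (a := 0) (b := T) _ _ cg) => //.
  - by move=> x; rewrite in_itv /= => /dg/@ex_derive.
  - by move=> x; rewrite in_itv /= => hx; rewrite derive1E (@derive_val _ _ _ _ _ _ _ (dg _ hx)) le0.
  - by rewrite in_itv /= t0.
  - by rewrite in_itv /= lexx.
rewrite g0 /g pmulr_lle0 ?expR_gt0 // => Et.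
have /eqP : E t = 0 by apply/eqP; rewrite eq_le Et E0.
rewrite psumr_eq0; last by move=> j _; rewrite -expr2 sqr_ge0.
by move=> /allP/(_ i (mem_index_enum i))/=; rewrite mulf_eq0 orbb => /eqP.
Qed.

End Calculus.

(** * Diagonal states *)

Section MatrixCurves.
Context {R : realType}.

Definition mderiv p q (t : R) (F : R -> 'M[R]_(p, q)) (D : 'M[R]_(p, q)) :=
  forall i j, is_derive t 1 (fun s => F s i j) (D i j).

Definition mcont p q (S : set R) (F : R -> 'M[R]_(p, q)) :=
  forall i j, {within S, continuous (fun s => F s i j)}.

Lemma mderiv_mull p q r t (A : 'M[R]_(r, p)) (F : R -> 'M[R]_(p, q)) D :
  mderiv t F D -> mderiv t (fun s => A *m F s) (A *m D).
Proof.
move=> H i j; under eq_fun do rewrite mxE; rewrite mxE.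
apply: is_derive_bigsum => k _.
have := is_deriveMfun (is_derive_cst (A i k) t 1) (H k j).
by rewrite mulr0 addr0.
Qed.

Lemma mderiv_mulr p q r t (B : 'M[R]_(q, r)) (F : R -> 'M[R]_(p, q)) D :
  mderiv t F D -> mderiv t (fun s => F s *m B) (D *m B).
Proof.
move=> H i j; under eq_fun do rewrite mxE; rewrite mxE.
apply: is_derive_bigsum => k _.
have := is_deriveMfun (H i k) (is_derive_cst (B k j) t 1).
by rewrite mulr0 add0r mulrC.
Qed.

Lemma is_derive_dgl p q t (F : R -> 'M[R]_(p, q)) D i :
  mderiv t F D -> is_derive t 1 (fun s => dgl (F s) i) (dgl D i).
Proof.
move=> H; apply: is_derive_bigsum => x _; apply: is_derive_bigsum => y _.
by case: (_ && _); [exact: H|exact: is_derive_cst].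
Qed.

Lemma mcont_mull p q r S (A : 'M[R]_(r, p)) (F : R -> 'M[R]_(p, q)) :
  mcont S F -> mcont S (fun s => A *m F s).
Proof.
move=> H i j; under eq_fun do rewrite mxE.
apply: within_continuous_sum => k _; apply: within_continuousM => //.
exact: within_continuous_cst.
Qed.

Lemma mcont_mulr p q r S (B : 'M[R]_(q, r)) (F : R -> 'M[R]_(p, q)) :
  mcont S F -> mcont S (fun s => F s *m B).
Proof.
move=> H i j; under eq_fun do rewrite mxE.
apply: within_continuous_sum => k _; apply: within_continuousM => //.
exact: within_continuous_cst.
Qed.

Lemma within_continuous_dgl p q S (F : R -> 'M[R]_(p, q)) i :
  mcont S F -> {within S, continuous (fun s => dgl (F s) i)}.
Proof.
move=> H; apply: within_continuous_sum => x _; apply: within_continuous_sum => y _.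
by case: (_ && _); [exact: H|exact: within_continuous_cst].
Qed.

(** * Projection onto matrices that are diagonal in fixed orthonormal bases *)

Section Block.
Variables (K a b p q : nat) (A : 'M[R]_(a, p)) (B : 'M[R]_(b, q)).
Hypotheses (hA : A^T *m A = 1%:M) (hB : B^T *m B = 1%:M).
Hypotheses (Kp : (K <= p)%N) (Kq : (K <= q)%N).

Definition dcoord (W : 'M[R]_(a, b)) (i : nat) : R :=
  if (i < K)%N then dgl (A^T *m W *m B) i else 0.

(** The linear projection that keeps the first K diagonal coordinates of W in the bases A and B.
    Being linear and constant in time, it commutes with differentiation along a curve. *)
Definition dproj (W : 'M[R]_(a, b)) : 'M[R]_(a, b) :=
  A *m rdiag p q (dcoord W) *m B^T.

Lemma dcoord_diag (c : nat -> R) i : (i < K)%N ->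
  dcoord (A *m rdiag p q c *m B^T) i = c i.
Proof.
move=> iK; rewrite /dcoord iK !mulmxA hA mul1mx -mulmxA hB mulmx1.
by rewrite dgl_rdiag // (leq_trans iK).
Qed.

Lemma dproj_diag (c : nat -> R) :
  (forall i, (K <= i)%N -> (i < p)%N -> (i < q)%N -> c i = 0) ->
  dproj (A *m rdiag p q c *m B^T) = A *m rdiag p q c *m B^T.
Proof.
move=> c0; congr (_ *m _ *m _); apply: eq_rdiag => i ip iq.
have [iK|Ki] := ltnP i K; first exact: dcoord_diag.
by rewrite c0 // /dcoord ltnNge Ki.
Qed.

Lemma mderiv_dproj t F D : mderiv t F D -> mderiv t (dproj \o F) (dproj D).
Proof.
move=> H; apply/mderiv_mulr/mderiv_mull => i j.
under eq_fun do rewrite mxE; rewrite mxE /dcoord.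
case: (_ == _); last exact: is_derive_cst.
case: (_ < _)%N; last exact: is_derive_cst.
exact/is_derive_dgl/mderiv_mulr/mderiv_mull.
Qed.

Lemma is_derive_dcoord t F D i :
  mderiv t F D -> is_derive t 1 (fun s => dcoord (F s) i) (dcoord D i).
Proof.
move=> H; rewrite /dcoord; case: (_ < _)%N; last exact: is_derive_cst.
exact/is_derive_dgl/mderiv_mulr/mderiv_mull.
Qed.

Lemma within_continuous_dcoord S F i :
  mcont S F -> {within S, continuous (fun s => dcoord (F s) i)}.
Proof.
move=> H; rewrite /dcoord; case: (_ < _)%N; last exact: within_continuous_cst.
exact/within_continuous_dgl/mcont_mulr/mcont_mull.
Qed.

Lemma mcont_dproj S F : mcont S F -> mcont S (dproj \o F).
Proof.
move=> H; apply/mcont_mulr/mcont_mull => i j; under eq_fun do rewrite mxE.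
case: (_ == _); last exact: within_continuous_cst.
exact: within_continuous_dcoord.
Qed.

Lemma mlipeq_dproj (X : Type) (S : set X) (N : X -> R) F G :
  mlipeq S N F G -> mlipeq S N (dproj \o F) (dproj \o G).
Proof.
move=> H; apply: mlipeq_mul; last exact: mlipeq_cst.
apply: mlipeq_mul; first exact: mlipeq_cst.
apply: mlipeq_rdiag => i; rewrite /dcoord; case: (_ < _)%N; last exact: lipeq_cst.
apply: lipeq_dgl; apply: mlipeq_mul; last exact: mlipeq_cst.
by apply: mlipeq_mul; first exact: mlipeq_cst.
Qed.

Definition offdiag (W : 'M[R]_(a, b)) := W - dproj W.

Lemma offdiagE W i j : offdiag W i j = W i j - dproj W i j.
Proof. by rewrite !mxE. Qed.

Lemma offdiag_diag (c : nat -> R) :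
  (forall i, (K <= i)%N -> (i < p)%N -> (i < q)%N -> c i = 0) ->
  offdiag (A *m rdiag p q c *m B^T) = 0.
Proof. by move=> c0; rewrite /offdiag dproj_diag ?subrr. Qed.

Lemma mderiv_offdiag t F D : mderiv t F D -> mderiv t (offdiag \o F) (offdiag D).
Proof.
move=> H i j; under eq_fun do rewrite /= offdiagE; rewrite offdiagE.
apply: is_deriveB; first exact: H.
exact: (mderiv_dproj H).
Qed.

Lemma mcont_offdiag S F : mcont S F -> mcont S (offdiag \o F).
Proof.
move=> H i j; under eq_fun do rewrite /= offdiagE.
by apply: within_continuousB; [exact: H|exact: (mcont_dproj H)].
Qed.

(* If [G] is diagonal, the off-diagonal part of [F] is that of [F - G]. *)
Lemma offdiag_bound (X : Type) (S : set X) (N : X -> R) F G i j :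
  mlipeq S N F G -> (forall t, offdiag (G t) = 0) ->
  exists C, forall t, S t -> `|offdiag (F t) i j| <= C * N t.
Proof.
move=> H G0.
have [_ [C hC]] := H i j; have [_ [C' hC']] := mlipeq_dproj H i j.
exists (C + C') => t St.
have -> : offdiag (F t) i j =
    (F t i j - G t i j) - (dproj (F t) i j - dproj (G t) i j).
  have : offdiag (G t) i j = 0 by rewrite G0 mxE.
  rewrite !offdiagE.
  by move=> /eqP; rewrite subr_eq0 => /eqP ->; ring.
rewrite mulrDl; apply: le_trans (ler_normB _ _) _.
by apply: lerD; [exact: hC|exact: hC'].
Qed.

(** Continuity on a compact interval supplies the uniform bounds, and the difference of the two
    curves is the off-diagonal part itself. *)
Lemma mlipeq_self_dproj (S : R) (N : R -> R) F : 0 <= S ->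
  mcont `[0, S] F ->
  (forall t i j, 0 <= t <= S -> `|offdiag (F t) i j| <= N t) ->
  mlipeq [set t | 0 <= t <= S] N F (dproj \o F).
Proof.
move=> S0 cF FN i j; split; last first.
  by exists 1 => t /= tS; rewrite mul1r -offdiagE FN.
have [b1 h1] := within_bounded S0 (cF i j).
have cG : mcont `[0, S] (dproj \o F) by exact: mcont_dproj.
have [b2 h2] := within_bounded S0 (cG i j).
exists (Num.max b1 b2) => t /= tS.
by rewrite !le_max h1 // (h2 t tS) orbT.
Qed.

End Block.
End MatrixCurves.

(** * The gradient at a diagonal state *)

Section DiagonalField.
Context {R : realType}.

(** The telescoping step: adjacent orthogonal factors cancel and the diagonals multiply. *)
Lemma sandwich_mul a b c p q r (A : 'M[R]_(a, p)) (B : 'M[R]_(b, q)) (C : 'M[R]_(c, r)) x y :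
  B^T *m B = 1%:M ->
  (forall i, (i < p)%N -> (i < r)%N -> (q <= i)%N -> x i * y i = 0) ->
  (A *m rdiag p q x *m B^T) *m (B *m rdiag q r y *m C^T) =
  A *m rdiag p r (fun i => x i * y i) *m C^T.
Proof.
move=> hB xy; rewrite !mulmxA -[_ *m B^T *m B]mulmxA hB mulmx1.
by rewrite -[A *m _ *m rdiag _ _ _]mulmxA rdiag_mul.
Qed.

Lemma sandwich_tr a b p q (A : 'M[R]_(a, p)) (B : 'M[R]_(b, q)) x :
  (A *m rdiag p q x *m B^T)^T = B *m rdiag q p x *m A^T.
Proof. by rewrite !trmx_mul trmxK tr_rdiag mulmxA. Qed.

(** Lets the single product formula [uchain_diag] serve for full chains too. *)
Lemma chain_uchain d (Wm : nat -> 'M[R]_d) k : chain d Wm k = uchain Wm k 0.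
Proof. by elim: k => //= k ->. Qed.

Variables (m n d L : nat) (Q : 'M[R]_n) (Rs : nat -> 'M[R]_d).
Hypotheses (n0 : (0 < n)%N) (L0 : (0 < L)%N) (Kd : (2 ^ m <= d)%N).
Hypothesis hQ : Q *m Q^T = 1%:M.
Hypothesis hQ1 : const_mx 1 = Num.sqrt (n%:R) *: (e1row n *m Q^T).
Hypothesis hR : forall l, (1 <= l <= L)%N -> Rs l *m (Rs l)^T = 1%:M.

Local Notation K := (2 ^ m)%N.
Local Notation V := (Vmx m n Q).
Local Notation U := (@Umx R m).
Local Notation Ksn := ((2 ^ m)%:R * Num.sqrt n%:R).

Lemma Rs_orth l : (1 <= l <= L)%N -> (Rs l)^T *m Rs l = 1%:M.
Proof. by move=> h; apply: mulmx1C; exact: hR. Qed.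

Lemma leq_nK : (K <= n * K)%N.
Proof. by rewrite leq_pmull. Qed.

Variable b : nat -> nat -> R.
Hypothesis b0 : forall l i, (K <= i)%N -> b l i = 0.

Let WL := U *m rdiag K d (b L) *m (Rs L)^T.
Let Wm l := Rs l.+1 *m rdiag d d (b l) *m (Rs l)^T.
Let H := Rs 1%N *m rdiag d (n * K) (b 0%N) *m V^T.

Lemma uchain_diag k l : (l <= k < L)%N ->
  uchain Wm k l =
  Rs k.+1 *m rdiag d d (fun i => \prod_(l.+1 <= r < k.+1) b r i) *m (Rs l.+1)^T.
Proof.
elim: k => [|k IH] /andP[lk kL].
  move: lk; rewrite leqn0 => /eqP->; rewrite /= (@eq_rdiag _ _ _ _ (fun=> 1)).
    by rewrite rdiag1 mulmx1 hR.
  by move=> i _ _; rewrite big_geq.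
rewrite /=; case: ltnP => kl.
  have -> : l = k.+1 by apply/eqP; rewrite eqn_leq lk.
  rewrite (@eq_rdiag _ _ _ _ (fun=> 1)); first by rewrite rdiag1 mulmx1 hR.
  by move=> i _ _; rewrite big_geq.
rewrite IH ?kl ?(ltnW kL) // /Wm sandwich_mul; last 2 first.
- by apply: Rs_orth; rewrite (ltnW kL).
- by move=> i id _; rewrite leqNgt id.
congr (_ *m _ *m _); apply: eq_rdiag => i _ _.
by rewrite [RHS]big_nat_recr //= mulrC.
Qed.

Lemma uchain_top l : (l < L)%N ->
  WL *m uchain Wm L.-1 l =
  U *m rdiag K d (fun i => \prod_(l.+1 <= r < L.+1) b r i) *m (Rs l.+1)^T.
Proof.
move=> lL; rewrite uchain_diag; last by rewrite -ltnS !prednK ?lL ?leqnn.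
rewrite prednK // sandwich_mul; last 2 first.
- by apply: Rs_orth; rewrite leqnn L0.
- by move=> i iK _; rewrite leqNgt (leq_trans iK).
congr (_ *m _ *m _); apply: eq_rdiag => i _ _.
by rewrite [RHS]big_nat_recr //= mulrC.
Qed.

Lemma chain_bottom l : (l < L)%N ->
  chain d Wm l *m H =
  Rs l.+1 *m rdiag d (n * K) (fun i => \prod_(0 <= r < l.+1) b r i) *m V^T.
Proof.
move=> lL; rewrite chain_uchain uchain_diag // sandwich_mul; last 2 first.
- by apply: Rs_orth; rewrite L0.
- by move=> i id _; rewrite leqNgt id.
congr (_ *m _ *m _); apply: eq_rdiag => i _ _.
by rewrite [RHS]big_nat_recl //= mulrC big_add1.
Qed.

Lemma logit_diag : WL *m chain d Wm L.-1 *m H =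
  U *m rdiag K (n * K) (fun i => \prod_(0 <= r < L.+1) b r i) *m V^T.
Proof.
rewrite -mulmxA chain_bottom ?prednK // sandwich_mul; last 2 first.
- by apply: Rs_orth; rewrite leqnn L0.
- by move=> i iK _; rewrite leqNgt (leq_trans iK).
congr (_ *m _ *m _); apply: eq_rdiag => i _ _.
by rewrite [RHS]big_nat_recr //= mulrC.
Qed.

(** The partial derivative of the loss in the [i]-th diagonal entry of layer [l]: the residual mode
    times the product of the entries of all other layers. *)
Definition dfield (c : nat -> nat -> R) (l i : nat) : R :=
  Num.sqrt n%:R * lam m (fun k => (\prod_(0 <= r < L.+1) c r k) / Ksn) i *
  ((\prod_(0 <= r < l) c r i) * \prod_(l.+1 <= r < L.+1) c r i).

(** For l < L the product contains the entry of layer L, which vanishes from K on. For l = L it is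
    empty, but that layer has only K rows. *)
Lemma prod_above0 l i : (l < L)%N -> (K <= i)%N ->
  \prod_(l.+1 <= r < L.+1) b r i = 0.
Proof. by move=> lL iK; rewrite big_nat_recr //= b0 // mulr0. Qed.

Lemma dfield0 l i : (l < L)%N -> (K <= i)%N -> dfield b l i = 0.
Proof. by move=> lL iK; rewrite /dfield prod_above0 // !mulr0. Qed.

Let G := gradZ (WL *m chain d Wm L.-1 *m H).

Lemma gradL_diag : G *m (chain d Wm L.-1 *m H)^T =
  U *m rdiag K d (dfield b L) *m (Rs L)^T.
Proof.
rewrite /G logit_diag gradZ_diag // chain_bottom ?prednK // sandwich_tr.
rewrite sandwich_mul; last 2 first.
- exact: Vmx_orth.
- by move=> i iK _; rewrite leqNgt (leq_trans iK) ?leq_nK.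
congr (_ *m _ *m _); apply: eq_rdiag => i _ _.
by rewrite /dfield [X in _ = _ * (_ * X)]big_geq // mulr1.
Qed.

Lemma gradH_diag : (WL *m chain d Wm L.-1)^T *m G =
  Rs 1%N *m rdiag d (n * K) (dfield b 0%N) *m V^T.
Proof.
rewrite /G logit_diag gradZ_diag // chain_uchain uchain_top // sandwich_tr.
rewrite sandwich_mul; last 2 first.
- exact: Umx_orth.
- by move=> i _ _ iK; rewrite prod_above0 // mul0r.
congr (_ *m _ *m _); apply: eq_rdiag => i _ _.
by rewrite /dfield [X in _ = _ * (X * _)]big_geq // mul1r mulrC.
Qed.

Lemma gradW_diag l : (1 <= l <= L.-1)%N ->
  (WL *m uchain Wm L.-1 l)^T *m G *m (chain d Wm l.-1 *m H)^T =
  Rs l.+1 *m rdiag d d (dfield b l) *m (Rs l)^T.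
Proof.
case/andP => l0 lL; have {}lL : (l < L)%N by rewrite -(prednK L0) ltnS.
rewrite /G logit_diag gradZ_diag // uchain_top // chain_bottom; last first.
  by rewrite prednK // ltnW.
rewrite prednK // !sandwich_tr -mulmxA sandwich_mul; last 2 first.
- exact: Vmx_orth.
- by move=> i iK _; rewrite leqNgt (leq_trans iK) ?leq_nK.
rewrite sandwich_mul; last 2 first.
- exact: Umx_orth.
- by move=> i _ _ iK; rewrite prod_above0 // mul0r.
congr (_ *m _ *m _); apply: eq_rdiag => i _ _.
by rewrite /dfield; ring.
Qed.

End DiagonalField.

(** * Invariance of the diagonal states *)

Lemma mid_bounds (L l : nat) : (1 <= l <= L.-1)%N -> (l == 0%N) = false /\ (l == L) = false.
Proof. by move=> /andP[l1 l2]; split; apply/negP => /eqP; lia. Qed.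

Lemma layer_cases (L l : nat) : (l <= L)%N -> [\/ l = 0%N, l = L | (1 <= l <= L.-1)%N].
Proof.
move=> lL; have [->|l1] := eqVneq l 0%N; first by constructor 1.
have [->|l2] := eqVneq l L; first by constructor 2.
constructor 3; lia.
Qed.

Lemma ord_mid (L : nat) (l : 'I_L) : (0 < l)%N -> (1 <= l <= L.-1)%N.
Proof. by move=> l0; have := ltn_ord l; lia. Qed.

Section Flow.
Context {R : realType}.
Variables (m n d L : nat).
Hypotheses (n0 : (0 < n)%N) (L0 : (0 < L)%N) (Kd : (2 ^ m <= d)%N).
Variable Q : 'M[R]_n.
Hypothesis hQ : Q *m Q^T = 1%:M.
Hypothesis hQ1 : const_mx 1 = Num.sqrt (n%:R) *: (e1row n *m Q^T).
Variable Rs : nat -> 'M[R]_d.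
Hypothesis hR : forall l, (1 <= l <= L)%N -> Rs l *m (Rs l)^T = 1%:M.
Variable T : R.
Variables (WL : R -> 'M[R]_(2 ^ m, d)) (Wm : R -> nat -> 'M[R]_d)
  (H : R -> 'M[R]_(d, 2 ^ m * n)).

Local Notation K := (2 ^ m)%N.
Local Notation V := (Vmx m n Q).
Local Notation U := (@Umx R m).

Hypothesis contL : mcont `[0, T[ WL.
Hypothesis contW : forall l, (1 <= l <= L.-1)%N -> mcont `[0, T[ (Wm^~ l).
Hypothesis contH : mcont `[0, T[ H.

Let gL (wl : 'M[R]_(K, d)) (wm : nat -> 'M[R]_d) (h : 'M[R]_(d, K * n)) :=
  gradZ (wl *m chain d wm L.-1 *m h) *m (chain d wm L.-1 *m h)^T.
Let gW (wl : 'M[R]_(K, d)) (wm : nat -> 'M[R]_d) (h : 'M[R]_(d, K * n)) l :=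
  (wl *m uchain wm L.-1 l)^T *m gradZ (wl *m chain d wm L.-1 *m h) *m
  (chain d wm l.-1 *m h)^T.
Let gH (wl : 'M[R]_(K, d)) (wm : nat -> 'M[R]_d) (h : 'M[R]_(d, K * n)) :=
  (wl *m chain d wm L.-1)^T *m gradZ (wl *m chain d wm L.-1 *m h).

Hypothesis flowL : forall t : R, 0 < t < T ->
  mderiv t WL (- gL (WL t) (Wm t) (H t)).
Hypothesis flowW : forall l, (1 <= l <= L.-1)%N -> forall t : R, 0 < t < T ->
  mderiv t (Wm^~ l) (- gW (WL t) (Wm t) (H t) l).
Hypothesis flowH : forall t : R, 0 < t < T ->
  mderiv t H (- gH (WL t) (Wm t) (H t)).

(* The candidate alpha^(l)_i, read off the trajectory in the fixed bases. *)
Definition sv (t : R) (l i : nat) : R :=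
  if l == 0%N then dcoord K (Rs 1%N) V (H t) i
  else if l == L then dcoord K U (Rs L) (WL t) i
  else dcoord K (Rs l.+1) (Rs l) (Wm t l) i.

Lemma sv_ge t l i : (K <= i)%N -> sv t l i = 0.
Proof. by move=> Ki; rewrite /sv /dcoord ltnNge Ki /=; case: (l == 0%N); case: (l == L). Qed.

(** The diagonal state rebuilt from the coordinates [sv], that is, the projection of the trajectory.
    The gradient there is computed exactly, and the true gradient is compared with it. *)
Let WLd t := U *m rdiag K d (sv t L) *m (Rs L)^T.
Let Wmd t l := Rs l.+1 *m rdiag d d (sv t l) *m (Rs l)^T.
Let Hd t := Rs 1%N *m rdiag d (n * K) (sv t 0%N) *m V^T.

Lemma WLdE t : WLd t = dproj K U (Rs L) (WL t).
Proof.
congr (_ *m _ *m _); apply: eq_rdiag => i _ _.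
by rewrite /sv eqn0Ngt L0 eqxx.
Qed.

Lemma WmdE t l : (1 <= l <= L.-1)%N -> Wmd t l = dproj K (Rs l.+1) (Rs l) (Wm t l).
Proof.
move=> hl; congr (_ *m _ *m _); apply: eq_rdiag => i _ _.
by have [h1 h2] := mid_bounds hl; rewrite /sv h1 h2.
Qed.

Lemma HdE t : Hd t = dproj K (Rs 1%N) V (H t).
Proof. by congr (_ *m _ *m _); apply: eq_rdiag => i _ _. Qed.

Let dfld t := dfield m n L (sv t).

Lemma sandwich_opp a b p q (A : 'M[R]_(a, p)) (B : 'M[R]_(b, q)) x :
  - (A *m rdiag p q x *m B^T) = A *m rdiag p q (fun i => - x i) *m B^T.
Proof. by rewrite -rdiagN mulmxN mulNmx. Qed.

Lemma gLdE t : - gL (WLd t) (Wmd t) (Hd t) =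
  U *m rdiag K d (fun i => - dfld t L i) *m (Rs L)^T.
Proof.
rewrite /gL gradL_diag // ?sandwich_opp // => l i; exact: sv_ge.
Qed.

Lemma gWdE t l : (1 <= l <= L.-1)%N -> - gW (WLd t) (Wmd t) (Hd t) l =
  Rs l.+1 *m rdiag d d (fun i => - dfld t l i) *m (Rs l)^T.
Proof.
by move=> hl; rewrite /gW gradW_diag // ?sandwich_opp // => k i; exact: sv_ge.
Qed.

Lemma gHdE t : - gH (WLd t) (Wmd t) (Hd t) =
  Rs 1%N *m rdiag d (n * K) (fun i => - dfld t 0%N i) *m V^T.
Proof.
rewrite /gH gradH_diag // ?sandwich_opp // => k i; exact: sv_ge.
Qed.

Lemma KnK : (K <= n * K)%N. Proof. exact: leq_nK. Qed.

Lemma orthU : U^T *m U = 1%:M. Proof. exact: Umx_orth. Qed.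
Lemma orthV : V^T *m V = 1%:M. Proof. exact: Vmx_orth. Qed.
Lemma orthR l : (1 <= l <= L)%N -> (Rs l)^T *m Rs l = 1%:M.
Proof. exact: Rs_orth. Qed.

Lemma dfld0 t l i : (l < L)%N -> (K <= i)%N -> - dfld t l i = 0.
Proof. by move=> lL iK; rewrite /dfld dfield0 ?oppr0 // => k j; exact: sv_ge. Qed.

Lemma mid_orth l : (1 <= l <= L.-1)%N ->
  (Rs l.+1)^T *m Rs l.+1 = 1%:M /\ (Rs l)^T *m Rs l = 1%:M.
Proof. by move=> hl; split; apply: orthR; lia. Qed.

(* The components of the state transverse to the manifold of diagonal factorizations. *)
Let idx : finType :=
  (('I_K * 'I_d) + ('I_L * ('I_d * 'I_d)) + ('I_d * 'I_(K * n)))%type.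

(** The middle layers are 1, ..., L-1 while ['I_L] starts at 0; the slot l = 0 is filled with the
    zero function. *)
Let off (fL : R -> 'M[R]_(K, d)) (fW : nat -> R -> 'M[R]_d)
    (fH : R -> 'M[R]_(d, K * n)) (x : idx) (t : R) : R :=
  match x with
  | inl (inl (p, q)) => offdiag K U (Rs L) (fL t) p q
  | inl (inr (l, (p, q))) =>
      if (0 < l)%N then offdiag K (Rs l.+1) (Rs l) (fW l t) p q else 0
  | inr (p, q) => offdiag K (Rs 1%N) V (fH t) p q
  end.

Hypothesis WL0 : offdiag K U (Rs L) (WL 0) = 0.
Hypothesis Wm0 : forall l, (1 <= l <= L.-1)%N ->
  offdiag K (Rs l.+1) (Rs l) (Wm 0 l) = 0.
Hypothesis H0 : offdiag K (Rs 1%N) V (H 0) = 0.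

Lemma mlipeq_opp (X : Type) (S : set X) (N : X -> R) p q (F G : X -> 'M[R]_(p, q)) :
  mlipeq S N F G -> mlipeq S N (fun t => - F t) (fun t => - G t).
Proof.
move=> h i j; under [X in lipeq _ _ X _]eq_fun do rewrite mxE.
by under [X in lipeq _ _ _ X]eq_fun do rewrite mxE; apply: lipeqN.
Qed.

Lemma off_eq0 t x : 0 <= t < T -> off WL (fun l s => Wm s l) H x t = 0.
Proof.
move=> /andP[t0 tT]; set y := off _ _ _.
pose dy := off (fun s => - gL (WL s) (Wm s) (H s))
  (fun l s => - gW (WL s) (Wm s) (H s) l) (fun s => - gH (WL s) (Wm s) (H s)).
pose N s := \sum_j `|y j s|.
pose S := [set s : R | 0 <= s <= t].
(* The trajectory may be unbounded near T, so the estimates are made on the compact interval [0, t]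
   with t < T. *)
have sub : `[0, t] `<=` `[0, T[.
  by move=> s; rewrite /= !in_itv /= => /andP[-> st]; apply: le_lt_trans tT.
have cL : mcont `[0, t] WL by move=> i j; apply: (continuous_subspaceW sub); exact: contL.
have cW l : (1 <= l <= L.-1)%N -> mcont `[0, t] (Wm^~ l).
  by move=> hl i j; apply: (continuous_subspaceW sub); exact: contW.
have cH : mcont `[0, t] H by move=> i j; apply: (continuous_subspaceW sub); exact: contH.
have yN j s : `|y j s| <= N s.
  by rewrite /N (bigD1 j) //= lerDl sumr_ge0.
have eL : mlipeq S N WL WLd.
  rewrite (funext WLdE : WLd = dproj K U (Rs L) \o WL).
  apply: mlipeq_self_dproj => // s i j _; exact: (yN (inl (inl (i, j)))).
have eW l : (1 <= l <= L.-1)%N -> mlipeq S N (Wm^~ l) (Wmd^~ l).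
  move=> hl; rewrite (funext (fun s => @WmdE s l hl) : Wmd^~ l = dproj K (Rs l.+1) (Rs l) \o Wm^~ l).
  have lL : (l < L)%N by lia.
  apply: mlipeq_self_dproj => //; first exact: cW.
  move=> s i j _; have := yN (inl (inr (Ordinal lL, (i, j)))) s.
  by rewrite {1}/y /=; case/andP: hl => ->.
have eH : mlipeq S N H Hd.
  rewrite (funext HdE : Hd = dproj K (Rs 1%N) V \o H).
  apply: mlipeq_self_dproj => // s i j _; exact: (yN (inr (i, j))).
have eC k : (k <= L.-1)%N -> mlipeq S N (fun s => chain d (Wm s) k) (fun s => chain d (Wmd s) k).
  move=> kL; apply: mlipeq_chain => l /andP[l1 l2]; apply: eW.
  by rewrite l1 (leq_trans l2).
have eU k : mlipeq S N (fun s => uchain (Wm s) L.-1 k) (fun s => uchain (Wmd s) L.-1 k).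
  by apply: mlipeq_uchain => l hl; apply: eW.
have eG : mlipeq S N (fun s => gradZ (WL s *m chain d (Wm s) L.-1 *m H s))
    (fun s => gradZ (WLd s *m chain d (Wmd s) L.-1 *m Hd s)).
  apply: mlipeq_gradZ; apply: mlipeq_mul => //; apply: mlipeq_mul => //; exact: eC.
(* The gradient at the projected state is diagonal, so the off-diagonal velocity only sees the
   difference of the two gradients, which is O(N) by the congruence calculus. *)
have bnd j : exists C, forall s, S s -> `|dy j s| <= C * N s.
  case: j => [[[i j]|[l [i j]]]|[i j]]; rewrite /dy /=.
  - apply: (offdiag_bound (G := fun s => - gL (WLd s) (Wmd s) (Hd s))).
      apply/mlipeq_opp/mlipeq_mul => //; apply/mlipeq_tr/mlipeq_mul => //.
      exact: eC.
    move=> s; rewrite gLdE offdiag_diag //; first exact: orthU.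
      by apply: orthR; rewrite L0 leqnn.
    by move=> k Kk; rewrite ltnNge Kk.
  - case: ltnP => l0; last by exists 0 => s _; rewrite normr0 mul0r.
    have hl := ord_mid l0; have [hR1 hR2] := mid_orth hl.
    apply: (offdiag_bound (G := fun s => - gW (WLd s) (Wmd s) (Hd s) l)).
      apply/mlipeq_opp/mlipeq_mul; last first.
        apply/mlipeq_tr/mlipeq_mul => //; apply: eC; lia.
      by apply: mlipeq_mul => //; apply/mlipeq_tr/mlipeq_mul.
    move=> s; rewrite gWdE // offdiag_diag // => k Kk _ _.
    by rewrite dfld0.
  - apply: (offdiag_bound (G := fun s => - gH (WLd s) (Wmd s) (Hd s))).
      apply/mlipeq_opp/mlipeq_mul => //; apply/mlipeq_tr/mlipeq_mul => //.
      exact: eC.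
    move=> s; rewrite gHdE offdiag_diag //.
    + by apply: orthR; rewrite L0.
    + exact: orthV.
    + exact: KnK.
    + by move=> k Kk _ _; rewrite dfld0.
(* There are finitely many components, so the sum of the absolute values of their constants serves
   for all of them. *)
have [C hC] := fin_all_exists bnd.
have C0 j : C j <= \sum_k `|C k|.
  by rewrite (bigD1 j) //= (le_trans (ler_norm _)) // lerDl sumr_ge0.
apply: (@gronwall_eq0 _ _ y dy t (\sum_k `|C k|)) => //; last by rewrite t0 lexx.
- case=> [[[i j]|[l [i j]]]|[i j]]; rewrite /y /off.
  + exact: (mcont_offdiag cL).
  + case: ltnP => l0; last exact: within_continuous_cst.
    exact: (mcont_offdiag (cW _ (ord_mid l0))).
  + exact: (mcont_offdiag cH).
- case=> [[[i j]|[l [i j]]]|[i j]]; rewrite /y /off.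
  + by rewrite WL0 mxE.
  + by case: ltnP => // l0; rewrite Wm0 ?mxE // ord_mid.
  + by rewrite H0 mxE.
- move=> j s /andP[s0 st]; have sT : 0 < s < T by rewrite s0 (lt_trans st).
  case: j => [[[i j]|[l [i j]]]|[i j]]; rewrite /y /dy /off /=.
  + exact: (mderiv_offdiag K U (Rs L) (flowL sT) i j).
  + case: ltnP => l0; last exact: is_derive_cst.
    exact: (mderiv_offdiag K (Rs l.+1) (Rs l) (flowW (ord_mid l0) sT) i j).
  + exact: (mderiv_offdiag K (Rs 1%N) V (flowH sT) i j).
- move=> j s /andP[s0 st]; apply: (le_trans (hC j s _)).
    by rewrite /S /= !ltW.
  by rewrite ler_wpM2r ?C0 // sumr_ge0.
Qed.

Lemma offdiag_eq0 K' a b p q (A : 'M[R]_(a, p)) (B : 'M[R]_(b, q)) W :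
  (forall i j, offdiag K' A B W i j = 0) -> W = dproj K' A B W.
Proof. by move=> h; apply/eqP; rewrite -subr_eq0; apply/eqP/matrixP => i j; rewrite [LHS]h mxE. Qed.

Lemma flow_diagL t : 0 <= t < T -> WL t = WLd t.
Proof.
by move=> ht; rewrite WLdE; apply: offdiag_eq0 => i j; exact: (off_eq0 (inl (inl (i, j))) ht).
Qed.

Lemma flow_diagW t l : (1 <= l <= L.-1)%N -> 0 <= t < T -> Wm t l = Wmd t l.
Proof.
move=> hl ht; rewrite WmdE //; apply: offdiag_eq0 => i j.
have lL : (l < L)%N by lia.
by have := off_eq0 (inl (inr (Ordinal lL, (i, j)))) ht; case/andP: hl => /= ->.
Qed.

Lemma flow_diagH t : 0 <= t < T -> H t = Hd t.
Proof.
by move=> ht; rewrite HdE; apply: offdiag_eq0 => i j; exact: (off_eq0 (inr (i, j)) ht).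
Qed.

(** Only layers 1, ..., k are compared, since the flow says nothing about [Wm] at other indices; an
    equality of whole sequences would not be available. *)
Lemma eq_uchain (wm wm' : nat -> 'M[R]_d) k j :
  (forall l, (1 <= l <= k)%N -> wm l = wm' l) -> uchain wm k j = uchain wm' k j.
Proof.
elim: k => //= k IH h; rewrite h ?leqnn // IH // => l /andP[l1 l2].
by apply: h; rewrite l1 leqW.
Qed.

Lemma flow_diag_uchain t k j : (k <= L.-1)%N -> 0 <= t < T ->
  uchain (Wm t) k j = uchain (Wmd t) k j.
Proof.
move=> kL ht; apply: eq_uchain => l /andP[l1 l2]; apply: flow_diagW => //.
by rewrite l1 (leq_trans l2).
Qed.

(** Once the trajectory is known to be diagonal, its gradient is the explicit one at the projected
    state, and the coordinate functional reads off the diagonal entry. *)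
Lemma is_derive_sv t l i : 0 < t < T -> (l <= L)%N -> (i < K)%N ->
  is_derive t 1 (fun s => sv s l i) (- dfield m n L (sv t) l i).
Proof.
move=> ht lL iK; have ht' : 0 <= t < T by case/andP: ht => /ltW -> ->.
have hR1 : (Rs 1%N)^T *m Rs 1%N = 1%:M by apply: orthR; rewrite L0.
have hRL : (Rs L)^T *m Rs L = 1%:M by apply: orthR; rewrite L0 leqnn.
have [->|->|hl] := layer_cases lL.
- under eq_fun do rewrite /sv eqxx.
  apply: is_derive_eq (is_derive_dcoord K (Rs 1%N) V i (flowH ht)) _.
  rewrite /gH chain_uchain (flow_diag_uchain _ (leqnn _) ht') flow_diagL // flow_diagH //.
  by rewrite -chain_uchain gHdE dcoord_diag //; [exact: orthV|exact: KnK].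
- under eq_fun do rewrite /sv eqn0Ngt L0 eqxx /=.
  apply: is_derive_eq (is_derive_dcoord K U (Rs L) i (flowL ht)) _.
  rewrite /gL chain_uchain (flow_diag_uchain _ (leqnn _) ht') flow_diagL // flow_diagH //.
  by rewrite -chain_uchain gLdE dcoord_diag //; exact: orthU.
- have [h1 h2] := mid_bounds hl; have [hR2 hR3] := mid_orth hl.
  under eq_fun do rewrite /sv h1 h2.
  apply: is_derive_eq (is_derive_dcoord K (Rs l.+1) (Rs l) i (flowW hl ht)) _.
  rewrite /gW !chain_uchain !(flow_diag_uchain _ _ ht') ?leqnn //; last by lia.
  by rewrite flow_diagL // flow_diagH // -!chain_uchain gWdE // dcoord_diag.
Qed.

Lemma within_continuous_sv l i : (l <= L)%N ->
  {within `[0, T[, continuous (fun s => sv s l i)}.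
Proof.
move=> lL; have [->|->|hl] := layer_cases lL.
- have -> : (fun s => sv s 0%N i) = (fun s => dcoord K (Rs 1%N) V (H s) i) by [].
  by apply: within_continuous_dcoord; exact: contH.
- have -> : (fun s => sv s L i) = (fun s => dcoord K U (Rs L) (WL s) i).
    by apply/funext => s; rewrite /sv eqn0Ngt L0 eqxx.
  by apply: within_continuous_dcoord; exact: contL.
- have -> : (fun s => sv s l i) = (fun s => dcoord K (Rs l.+1) (Rs l) (Wm s l) i).
    by apply/funext => s; rewrite /sv; have [-> ->] := mid_bounds hl.
  by apply: within_continuous_dcoord; exact: contW.
Qed.

End Flow.

(** * The reduced system *)

Section Scalar.
Context {R : realType}.

Lemma is_derive_bigprod (f : nat -> R -> R) (df : nat -> R) (x : R) (N : nat) :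
  (forall l, (l < N)%N -> is_derive x 1 (f l) (df l)) ->
  is_derive x 1 (fun s => \prod_(0 <= l < N) f l s)
    (\sum_(0 <= l < N) df l *
      ((\prod_(0 <= r < l) f r x) * \prod_(l.+1 <= r < N) f r x)).
Proof.
elim: N => [|N IH] h.
  under eq_fun do rewrite big_geq //.
  by rewrite big_geq //; exact: is_derive_cst.
under eq_fun do rewrite big_nat_recr //=.
have h1 := IH (fun l lN => h l (ltnW lN)).
apply: is_derive_eq (is_deriveMfun h1 (h N (leqnn _))) _.
rewrite [RHS]big_nat_recr //= [X in _ * (_ * X)]big_geq // mulr1 [RHS]addrC.
congr (_ + _); first by rewrite mulrC.
rewrite mulr_sumr !big_mkord; apply: eq_bigr => l _.
by rewrite [in RHS](@big_nat_recr _ _ _ N) //=; ring.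
Qed.

Lemma within_continuous_bigprod (S : set R) (f : nat -> R -> R) (N : nat) :
  (forall l, (l < N)%N -> {within S, continuous (f l)}) ->
  {within S, continuous (fun u => \prod_(0 <= l < N) f l u)}.
Proof.
elim: N => [|N IH] h.
  by under eq_fun do rewrite big_geq //; exact: within_continuous_cst.
under eq_fun do rewrite big_nat_recr //=.
apply: within_continuousM; last exact: h.
by apply: IH => l lN; apply: h; exact: ltnW.
Qed.

(** Puts the missing layer back into the product over the other layers. *)
Lemma prod_split (c : nat -> R) (l N : nat) : (l <= N)%N ->
  c l * ((\prod_(0 <= r < l) c r) * \prod_(l.+1 <= r < N.+1) c r) =
  \prod_(0 <= r < N.+1) c r.
Proof.
move=> lN; rewrite [RHS](@big_cat_nat _ _ _ l) //=; last exact: leqW.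
by rewrite [X in _ = _ * X]big_ltn ?ltnS //; ring.
Qed.

Lemma const_of_derive0 (f : R -> R) (T : R) :
  {within `[0, T[, continuous f} ->
  (forall t, 0 < t < T -> is_derive t 1 f 0) ->
  forall t, 0 <= t < T -> f t = f 0.
Proof.
move=> cf df t /andP[t0 tT].
have D s : s \in `]0, T[%R -> derivable f s 1.
  by rewrite in_itv /= => /df/@ex_derive.
have D0 s : s \in `]0, T[%R -> derive1 f s = 0.
  by rewrite in_itv /= => /df hs; rewrite derive1E (@derive_val _ _ _ _ _ _ _ hs).
have i0 : 0 \in `[0, T[%R by rewrite in_itv /= lexx (le_lt_trans t0).
have it : t \in `[0, T[%R by rewrite in_itv /= t0.
apply/eqP; rewrite eq_le; apply/andP; split.
  by apply: (ler0_derive1_le_co D _ cf) => // s /D0 ->.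
by apply: (ger0_derive1_le_co D _ cf) => // s /D0 ->.
Qed.

Lemma eq_Psi_a m (a a' : nat -> R) j :
  (forall k, (k < 2 ^ m)%N -> a k = a' k) -> Psi_a m a j = Psi_a m a' j.
Proof. by move=> h; apply: eq_big_nat => k /andP[_ hk]; rewrite h. Qed.

Lemma eq_lam m (a a' : nat -> R) i :
  (forall k, (k < 2 ^ m)%N -> a k = a' k) -> lam m a i = lam m a' i.
Proof.
by move=> h; congr (- (_ / (1 + _))); apply: eq_bigr => j _; rewrite (eq_Psi_a _ h).
Qed.

Variables (m n L : nat) (T : R) (s : R -> nat -> nat -> R).
Hypothesis n0 : (0 < n)%N.
Local Notation K := (2 ^ m)%N.
Local Notation Ksn := ((2 ^ m)%:R * Num.sqrt n%:R : R).
Hypothesis ds : forall (t : R) l i, 0 < t < T -> (l <= L)%N -> (i < K)%N ->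
  is_derive t 1 (fun u => s u l i) (- dfield m n L (s t) l i).
Hypothesis cs : forall l i, (l <= L)%N -> {within `[0, T[, continuous (fun u => s u l i)}.

(** Multiplying the velocity of layer [l] by its own entry completes the product over all layers, so
    half the derivative of the square is the same for every layer. *)
Lemma sv_conserved (t : R) l r i : 0 <= t < T -> (l <= L)%N -> (r <= L)%N -> (i < K)%N ->
  s t l i ^+ 2 - s t r i ^+ 2 = s 0 l i ^+ 2 - s 0 r i ^+ 2.
Proof.
move=> ht lL rL iK.
apply: (@const_of_derive0 (fun u => s u l i ^+ 2 - s u r i ^+ 2) T) => //.
  by apply: within_continuousB; apply: within_continuousM; exact: cs.
move=> u hu; have hl := ds hu lL iK; have hr := ds hu rL iK.
apply: is_derive_eq (is_deriveB (is_deriveMfun hl hl) (is_deriveMfun hr hr)) _.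
have E k : (k <= L)%N -> s u k i * - dfield m n L (s u) k i =
  - (Num.sqrt n%:R * lam m (fun k => (\prod_(0 <= r < L.+1) s u r k) / Ksn) i *
     \prod_(0 <= r < L.+1) s u r i).
  by move=> kL; rewrite -(prod_split (fun r => s u r i) kL) /dfield; ring.
by rewrite !E // subrr.
Qed.

(** The first row of Phi is constant, hence b_0 = 0 and this mode feels no force. *)
Lemma sv_zero_mode (t : R) l : 0 <= t < T -> (l <= L)%N -> s t l 0%N = s 0 l 0%N.
Proof.
move=> ht lL; apply: (@const_of_derive0 (fun u => s u l 0%N) T) => //; first exact: cs.
move=> u hu; apply: is_derive_eq (ds hu lL _) _; first exact: expn_gt0.
by rewrite /dfield lam0 mulr0 mul0r oppr0.
Qed.

Definition logit_sv (t : R) i := \prod_(0 <= r < L.+1) s t r i.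

(** By the Leibniz rule each layer contributes the square of the product over the other layers,
    because its velocity already carries that product once. All signs are therefore decided by b_i
    >= 0. *)
Definition logit_rate (t : R) i := Num.sqrt n%:R * - lam m (fun k => logit_sv t k / Ksn) i *
  \sum_(0 <= l < L.+1) ((\prod_(0 <= r < l) s t r i) * \prod_(l.+1 <= r < L.+1) s t r i) ^+ 2.

Lemma is_derive_prod_sv (t : R) i : 0 < t < T -> (i < K)%N ->
  is_derive t 1 (logit_sv^~ i) (logit_rate t i).
Proof.
move=> ht iK.
apply: is_derive_eq (is_derive_bigprod (f := fun l u => s u l i) (N := L.+1) _) _.
  by move=> l lL; exact: ds.
by rewrite /logit_rate mulr_sumr; apply: eq_bigr => l _; rewrite /dfield; ring.
Qed.

Lemma logit_rate_ge0 (t : R) i : 0 <= logit_rate t i.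
Proof.
rewrite mulr_ge0 ?sumr_ge0 // => [|l _]; last exact: sqr_ge0.
rewrite mulr_ge0 ?sqrtr_ge0 // /lam opprK divr_ge0 ?bcoef_ge0 //.
by rewrite ltW // Dden_gt0.
Qed.

(** The signs of the separate factors are not followed in time; monotonicity of the product is
    enough. *)
Lemma prod_sv_ge0 (t : R) i : 0 <= t < T -> (i < K)%N -> 
  (forall l, (l <= L)%N -> 0 <= s 0 l i) -> 0 <= logit_sv t i.
Proof.
move=> /andP[t0 tT] iK h0.
have A0 : 0 <= logit_sv 0 i.
  by rewrite /logit_sv big_mkord prodr_ge0 // => l _; apply: h0; rewrite -ltnS.
apply: le_trans A0 _.
have cA : {within `[0, T[, continuous (logit_sv^~ i)}.
  by apply: within_continuous_bigprod => l lL; exact: cs.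
apply: (ger0_derive1_le_co _ _ cA) => //.
- by move=> u; rewrite in_itv /= => hu; exact: (@ex_derive _ _ _ _ _ _ _ (is_derive_prod_sv hu iK)).
- move=> u; rewrite in_itv /= => hu.
  by rewrite derive1E (@derive_val _ _ _ _ _ _ _ (is_derive_prod_sv hu iK)) logit_rate_ge0.
- by rewrite in_itv /= lexx (le_lt_trans t0).
- by rewrite in_itv /= t0.
Qed.

Lemma Ksn_gt0 : 0 < Ksn.
Proof. by rewrite mulr_gt0 ?pow2_gt0 // sqrtn_gt0. Qed.

(** [p] is the exponent 2L/(L+1) and [c] the time factor in t' = c t. *)
Local Notation p := ((2 * L)%:R / (L.+1)%:R : R).
Local Notation c := ((L.+1)%:R * (Ksn `^ p) / (2 ^ m)%:R : R).

Lemma time_scale_gt0 : 0 < c.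
Proof. by rewrite divr_gt0 ?pow2_gt0 // mulr_gt0 ?powR_gt0 ?Ksn_gt0. Qed.

(** With v the common absolute value of the layers, a_i = v^(L+1) and the Leibniz sum is (L+1)
    v^(2L) = (L+1) a_i^p. The factors L+1, K and K sqrt n are then absorbed by the rescalings of a
    and t. *)
Lemma balanced_rhs (t : R) i : 0 <= t < T -> (i < K)%N ->
  (forall l, (l <= L)%N -> 0 <= s 0 l i) ->
  (forall l r, (l <= L)%N -> (r <= L)%N -> s 0 l i = s 0 r i) ->
  Ksn^-1 * (logit_rate t i * c^-1) =
  - lam m (fun k => logit_sv t k / Ksn) i * (logit_sv t i / Ksn) `^ p.
Proof.
move=> ht iK h0 hb; have A0 := prod_sv_ge0 ht iK h0.
pose v : R := `|s t 0%N i|.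
have v0 : 0 <= v by exact: normr_ge0.
have E l : (l <= L)%N -> s t l i ^+ 2 = v ^+ 2.
  move=> lL; have := @sv_conserved t l 0%N i ht lL (leq0n _) iK.
  by rewrite (hb l 0%N) // subrr => /eqP; rewrite subr_eq0 /v real_normK ?num_real // => /eqP.
have P (a b : nat) : (b <= L.+1)%N -> (\prod_(a <= r < b) s t r i) ^+ 2 = v ^+ (2 * (b - a)).
  move=> bL; rewrite -prodrXl exprM -prodr_const_nat; apply: eq_big_nat => r /andP[_ rb].
  by rewrite E // -ltnS (leq_trans rb).
(* Squares of the layers determine only the square of the product; nonnegativity [A0] selects the
   root. *)
have AE : logit_sv t i = v ^+ L.+1.
  apply/eqP; rewrite -(@eqrXn2 _ 2) ?exprn_ge0 // /logit_sv P // subn0 -exprM mulnC //.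
have SE : \sum_(0 <= l < L.+1) ((\prod_(0 <= r < l) s t r i) *
    \prod_(l.+1 <= r < L.+1) s t r i) ^+ 2 = (L.+1)%:R * v ^+ (2 * L).
  rewrite (@eq_big_nat _ _ _ _ _ _ (fun=> v ^+ (2 * L))); last first.
    move=> l /andP[_ lL]; rewrite exprMn !P //; last exact: ltnW.
    by rewrite -exprD; congr (_ ^+ _); lia.
  by rewrite sumr_const_nat subn0 mulr_natl.
have pE : (logit_sv t i) `^ p = v ^+ (2 * L).
  rewrite AE -powR_mulrn // -powRrM mulrC divfK ?pnatr_eq0 //.
  by rewrite powR_mulrn.
have iE : Ksn^-1 `^ p = (Ksn `^ p)^-1.
  by rewrite -(powR_inv1 (ltW Ksn_gt0)) -powRrM mulN1r powRN.
rewrite powRM ?invr_ge0 ?(ltW Ksn_gt0) // pE iE.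
rewrite /logit_rate SE.
have h1 := lt0r_neq0 (powR_gt0 p Ksn_gt0); have h2 := lt0r_neq0 (@sqrtn_gt0 R n n0).
have h3 := lt0r_neq0 (@pow2_gt0 R m); have h4 : (L.+1)%:R != 0 :> R by rewrite pnatr_eq0.
by field; rewrite h1 h2 h3 nat1r h4.
Qed.

End Scalar.

(** * The factors of the initialization as rectangular diagonal matrices *)

Section Factors.
Context {R : realType}.

Lemma DL_rdiag m d (a : nat -> R) : DL m d a = rdiag (2 ^ m) d a.
Proof. by apply/matrixP => i j; rewrite !mxE. Qed.

Lemma Dmid_rdiag m d (a : nat -> R) :
  Dmid m d a = rdiag d d (fun i => if (i < 2 ^ m)%N then a i else 0).
Proof. by apply/matrixP => i j; rewrite !mxE /=; case: (_ == _). Qed.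

Lemma D0_rdiag m n d (a : nat -> R) :
  D0 m n d a = rdiag d (n * 2 ^ m) (fun i => if (i < 2 ^ m)%N then a i else 0).
Proof. by apply/matrixP => i j; rewrite !mxE /=; case: (_ == _). Qed.

End Factors.

Theorem theorem4p2 (R : realType) (m n d L : nat)
  (hn : (0 < n)%N) (hL : (0 < L)%N) (hd : (2 ^ m <= d)%N)
  (Q : 'M[R]_n) (hQ : Q *m Q^T = 1%:M)
  (hQ1 : const_mx 1 = Num.sqrt (n%:R) *: (e1row n *m Q^T))
  (Rs : nat -> 'M[R]_d)
  (hR : forall l, (1 <= l <= L)%N -> Rs l *m (Rs l)^T = 1%:M)
  (alpha0 : nat -> nat -> R)
  (halpha0 : forall l i, (l <= L)%N -> (i < 2 ^ m)%N -> 0 <= alpha0 l i)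
  (T : R) (hT : 0 < T)
  (WL : R -> 'M[R]_(2 ^ m, d)) (Wm : R -> nat -> 'M[R]_d)
  (H : R -> 'M[R]_(d, 2 ^ m * n))
  (* initialization *)
  (hWL0 : WL 0 = Umx m *m DL m d (alpha0 L) *m (Rs L)^T)
  (hWm0 : forall l, (1 <= l <= L.-1)%N ->
     Wm 0 l = Rs l.+1 *m Dmid m d (alpha0 l) *m (Rs l)^T)
  (hH0 : H 0 = Rs 1%N *m D0 m n d (alpha0 0%N) *m (Vmx m n Q)^T)
  (* theta is a gradient-flow trajectory on [0, T) *)
  (hcontL : forall p q, {within `[0, T[%classic, continuous (fun t : R => WL t p q)})
  (hcontm : forall l, (1 <= l <= L.-1)%N ->
     forall p q, {within `[0, T[%classic, continuous (fun t : R => Wm t l p q)})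
  (hcontH : forall p q, {within `[0, T[%classic, continuous (fun t : R => H t p q)})
  (hflow : forall t, 0 < t < T ->
     (forall p q, is_derive t 1 (fun s => WL s p q)
                    (- grad_WL m n d L (WL t) (Wm t) (H t) p q)) /\
     (forall l, (1 <= l <= L.-1)%N -> forall p q,
        is_derive t 1 (fun s => Wm s l p q)
                    (- grad_Wm m n d L (WL t) (Wm t) (H t) l p q)) /\
     (forall p q, is_derive t 1 (fun s => H s p q)
                    (- grad_H m n d L (WL t) (Wm t) (H t) p q))) :
  exists alpha : R -> nat -> nat -> R,
    (* U, V, R_l stay fixed; only the alpha's evolve *)
    (forall t, 0 <= t < T ->
       WL t = Umx m *m DL m d (alpha t L) *m (Rs L)^T /\
       (forall l, (1 <= l <= L.-1)%N ->
          Wm t l = Rs l.+1 *m Dmid m d (alpha t l) *m (Rs l)^T) /\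
       H t = Rs 1%N *m D0 m n d (alpha t 0%N) *m (Vmx m n Q)^T) /\
    (forall l i, alpha 0 l i = alpha0 l i) /\
    (* conserved quantities *)
    (forall t, 0 <= t < T -> forall l r i, (l <= L)%N -> (r <= L)%N ->
       (i < 2 ^ m)%N ->
       alpha t l i ^+ 2 - alpha t r i ^+ 2 = alpha0 l i ^+ 2 - alpha0 r i ^+ 2) /\
    (* alpha_0^(l) is constant *)
    (forall t, 0 <= t < T -> forall l, (l <= L)%N -> alpha t l 0%N = alpha0 l 0%N) /\
    (* reduced dynamics under balancedness, after the change of variables *)
    ((forall l r i, (l <= L)%N -> (r <= L)%N -> (i < 2 ^ m)%N ->
        alpha0 l i = alpha0 r i) ->
     let Ksn := (2 ^ m)%:R * Num.sqrt (n%:R) : R in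
     let c := (L.+1)%:R * (Ksn `^ ((2 * L)%:R / (L.+1)%:R)) / (2 ^ m)%:R in
     let a := fun (t' : R) (i : nat) =>
        Ksn^-1 * \prod_(l < L.+1) alpha (t' / c) l i in
     forall t', 0 < t' < c * T -> forall i, (1 <= i < 2 ^ m)%N ->
       is_derive t' 1 (fun s => a s i)
         ((Dden m (a t'))^-1 * bcoef m (a t') i *
            (a t' i) `^ ((2 * L)%:R / (L.+1)%:R))).

Proof.
pose K := (2 ^ m)%N; pose V := Vmx m n Q; pose U := @Umx R m.
have oU : U^T *m U = 1%:M := Umx_orth m.
have oV : V^T *m V = 1%:M := Vmx_orth m hQ.
have oR l : (1 <= l <= L)%N -> (Rs l)^T *m Rs l = 1%:M := fun h => Rs_orth hR h.
have KnK : (K <= n * K)%N := leq_nK m hn.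
have cL : mcont `[0, T[ WL by move=> i j; exact: hcontL.
have cW l : (1 <= l <= L.-1)%N -> mcont `[0, T[ (Wm^~ l).
  by move=> hl i j; exact: hcontm.
have cH : mcont `[0, T[ H by move=> i j; exact: hcontH.
(* The entrywise gradient-flow equations are restated with the closed matrix formulas for the
   gradients. *)
have fL (t : R) : 0 < t < T -> mderiv t WL (- (gradZ (WL t *m chain d (Wm t) L.-1 *m H t) *m
    (chain d (Wm t) L.-1 *m H t)^T)).
  move=> ht i j; have [h _] := hflow t ht.
  by rewrite mxE -grad_WLE; exact: h.
have fW l : (1 <= l <= L.-1)%N -> forall t : R, 0 < t < T -> mderiv t (Wm^~ l)
    (- ((WL t *m uchain (Wm t) L.-1 l)^T *m gradZ (WL t *m chain d (Wm t) L.-1 *m H t) *m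
        (chain d (Wm t) l.-1 *m H t)^T)).
  move=> hl t ht i j; have [_ [h _]] := hflow t ht.
  by rewrite mxE -grad_WmE //; exact: h.
have fH (t : R) : 0 < t < T -> mderiv t H (- ((WL t *m chain d (Wm t) L.-1)^T *m
    gradZ (WL t *m chain d (Wm t) L.-1 *m H t))).
  move=> ht i j; have [_ [_ h]] := hflow t ht.
  by rewrite mxE -grad_HE; exact: h.
have R1 : (1 <= 1 <= L)%N by rewrite hL.
have RL : (1 <= L <= L)%N by rewrite hL leqnn.
have Rm l : (1 <= l <= L.-1)%N -> (1 <= l <= L)%N /\ (1 <= l.+1 <= L)%N by lia.
have oL : offdiag K U (Rs L) (WL 0) = 0.
  rewrite hWL0 DL_rdiag offdiag_diag //; first exact: oR.
  by move=> i Ki; rewrite ltnNge Ki.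
have oW l : (1 <= l <= L.-1)%N -> offdiag K (Rs l.+1) (Rs l) (Wm 0 l) = 0.
  move=> hl; have [h1 h2] := Rm _ hl.
  rewrite hWm0 // Dmid_rdiag offdiag_diag //; [exact: oR|exact: oR|].
  by move=> i Ki _ _; rewrite ltnNge Ki.
have oH : offdiag K (Rs 1%N) V (H 0) = 0.
  rewrite hH0 D0_rdiag offdiag_diag //; first exact: oR.
  by move=> i Ki _ _; rewrite ltnNge Ki.
pose s := sv L Q Rs WL Wm H.
have s0 l i : (l <= L)%N -> (i < K)%N -> s 0 l i = alpha0 l i.
  move=> lL iK; rewrite /s /sv; have [->|->|hl] := layer_cases lL.
  - by rewrite eqxx hH0 D0_rdiag dcoord_diag ?iK //; exact: oR.
  - by rewrite eqn0Ngt hL eqxx /= hWL0 DL_rdiag dcoord_diag //; exact: oR.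
  - have [-> ->] := mid_bounds hl; have [h1 h2] := Rm _ hl.
    by rewrite hWm0 // Dmid_rdiag dcoord_diag ?iK //; exact: oR.
have ds (t : R) l i : 0 < t < T -> (l <= L)%N -> (i < K)%N ->
    is_derive t 1 (fun u => s u l i) (- dfield m n L (s t) l i).
  exact: (is_derive_sv hn hL hd hQ hQ1 hR cL cW cH fL fW fH oL oW oH).
have cs l i : (l <= L)%N -> {within `[0, T[, continuous (fun u => s u l i)}.
  by move=> lL; apply: within_continuous_sv.
(* Outside the meaningful range [alpha] is set to [alpha0], because agreement at time 0 is asked for
   all indices. *)
pose alpha t l i := if (l <= L)%N && (i < K)%N then s t l i else alpha0 l i.
have aE t l i : (l <= L)%N -> (i < K)%N -> alpha t l i = s t l i.
  by rewrite /alpha => -> ->.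
(* The truncation in [Dmid] and [D0] hides these default values, and [sv] vanishes from K on. *)
have trE t l i : (l <= L)%N -> (if (i < K)%N then alpha t l i else 0) = s t l i.
  move=> lL; case: ltnP => iK; first exact: aE.
  by rewrite /s sv_ge.
exists alpha; split; [|split; [|split; [|split]]].
- move=> t ht; split; [|split].
  + rewrite DL_rdiag (eq_rdiag (b := s t L)) => [|i iK _]; last exact: aE.
    exact: (flow_diagL hn hL hd hQ hQ1 hR cL cW cH fL fW fH oL oW oH ht).
  + move=> l hl; have [/andP[_ lL] _] := Rm _ hl.
    rewrite Dmid_rdiag (eq_rdiag (b := s t l)) => [|i _ _]; last exact: trE.
    exact: (flow_diagW hn hL hd hQ hQ1 hR cL cW cH fL fW fH oL oW oH hl ht).
  + rewrite D0_rdiag (eq_rdiag (b := s t 0%N)) => [|i _ _]; last exact: trE.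
    exact: (flow_diagH hn hL hd hQ hQ1 hR cL cW cH fL fW fH oL oW oH ht).
- by move=> l i; rewrite /alpha; case: ifP => // /andP[lL iK]; rewrite s0.
- move=> t ht l r i lL rL iK; rewrite !aE // (sv_conserved ds cs ht lL rL iK).
  by rewrite !s0.
- move=> t ht l lL; rewrite aE ?expn_gt0 // (sv_zero_mode ds cs ht lL).
  by rewrite s0 ?expn_gt0.
move=> hb Ksn c a t' /andP[t0 tT] i /andP[_ iK].
have c0 : 0 < c := time_scale_gt0 m L hn.
(* The original time t'/c lies in (0, T) exactly when t' lies in (0, c T). *)
have ht : 0 < t' / c < T by rewrite divr_gt0 //= ltr_pdivrMr // mulrC.
have ht' : 0 <= t' / c < T by case/andP: ht => /ltW -> ->.
have logE u k : (k < K)%N -> a u k = logit_sv L s (u / c) k / Ksn.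
  move=> kK; rewrite /a /logit_sv mulrC big_mkord; congr (_ / _).
  by apply: eq_bigr => l _; rewrite aE // -ltnS.
have dg : is_derive t' 1 (fun u : R => u / c) c^-1.
  by have := is_derive_affine 0 c^-1 t'; under eq_fun do rewrite add0r.
have := is_derive1_comp (g := fun u => u / c) (is_derive_prod_sv ds ht iK) dg.
move=> /(is_deriveMfun (is_derive_cst Ksn^-1 t' 1)).
rewrite mulr0 addr0 (balanced_rhs hn ds cs ht' iK); last 2 first.
- by move=> l lL; rewrite s0 // halpha0.
- by move=> l r lL rL; rewrite !s0 // (hb l r).
have -> : (fun u => cst Ksn^-1 u * ((logit_sv L s)^~ i \o (fun u => u / c)) u) = a^~ i.
  by apply/funext => u; rewrite logE //= mulrC.
(* The two sequences inside [lam] are known to agree only below K, which is all that [lam] reads. *)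
rewrite -logE // (eq_lam (a' := a t')) => [|k kK]; last by rewrite logE.
by rewrite /lam opprK [_ / Dden _ _]mulrC.
Qed.
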